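(* Let $t\ge 1$ and let $(\mathrm{Enc}^t,\mathrm{Dec}^t)$ be an $\varepsilon$-secure quantum non-malleable code against $\mathsf{LO}^t$ with message length $k$ qubits and blocklength $n$ qubits. Fix an integer $0<\lambda<k$ and define a code $(\mathrm{Enc},\mathrm{Dec})$ on $t+1$ shares for $(k-\lambda)$-qubit messages as follows. $\mathrm{Enc}(\sigma_M)=\big((\mathrm{Enc}^t)_{ME}\otimes \mathrm{id}_{\hat E}\big)(\sigma_M\otimes\Phi^{\otimes\lambda}_{E\hat E})$, where $\Phi^{\otimes\lambda}_{E\hat E}$ is $\lambda$ EPR pairs on registers $E,\hat E$ of $\lambda$ qubits each; the first $t$ shares are the $t$ shares of $\mathrm{Enc}^t$ and the $(t+1)$-st share is $\hat E$. $\mathrm{Dec}$: apply $\mathrm{Dec}^t$ to the first $t$ shares, obtaining registers $M'E'$; measure $E'$ together with the $(t+1)$-st share with the two-outcome projective measurement $\{\Phi^{\otimes\lambda},\ \mathbb I-\Phi^{\otimes\lambda}\}$; if the outcome is $\Phi^{\otimes\lambda}$ output $M'$, otherwise output $\bot$. Then $(\mathrm{Enc},\mathrm{Dec})$ is an $(\varepsilon+2^{1-\lambda})$-secure quantum tamper-detection code against $\mathsf{LO}^{t+1}$ with message length $k-\lambda$ and blocklength $n+\lambda$.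
   Context: A quantum code on $t$ shares is a pair of CPTP maps $\mathrm{Enc}:\mathcal L(\mathcal H_M)\to\mathcal L(\mathcal H_{X_1}\otimes\cdots\otimes\mathcal H_{X_t})$ and $\mathrm{Dec}$ in the reverse direction (the decoder may additionally output a special state $\bot$ orthogonal to $\mathcal H_M$), satisfying $(\mathrm{Dec}\circ\mathrm{Enc}\otimes\mathrm{id})(\sigma_{M\hat M})=\sigma_{M\hat M}$ for every state; the blocklength is the total number of qubits of the shares. The class $\mathsf{LO}^t_{(e_1,\dots,e_t)}$ consists of adversaries $\mathcal A=(\Lambda_1,\dots,\Lambda_t,|\psi\rangle_{E_1\cdots E_t})$ with $|E_i|\le e_i$ qubits (an entry $*$ means unbounded), each $\Lambda_i$ a CPTP map on $X_iE_i$ (output $X_iE_i'$); the tampering channel is $\rho\mapsto\mathrm{Tr}_{E'_1\cdots E'_t}[(\Lambda_1\otimes\cdots\otimes\Lambda_t)(\rho\otimes\psi)]$. $\mathsf{LO}^t$ is the case $e_i=0$ for all $i$, i.e. channels $\Lambda_1\otimes\cdots\otimes\Lambda_t$. For a message $\sigma_M$ with canonical purification $\sigma_{M\hat M}$ let $\eta_{M'\hat M}=(\mathrm{Dec}\circ\mathcal A\circ\mathrm{Enc}\otimes\mathrm{id}_{\hat M})(\sigma_{M\hat M})$. The code is an $\varepsilon$-secure quantum non-malleable code against a class if for every adversary $\mathcal A$ in it there are $p_{\mathcal A}\in[0,1]$ and a state $\gamma_{M'}$ depending only on $\mathcal A$ such that for every $\sigma_M$, $\|\eta_{M'\hat M}-(p_{\mathcal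 A}\sigma_{M\hat M}+(1-p_{\mathcal A})\gamma_{M'}\otimes\sigma_{\hat M})\|_1\le\varepsilon$. It is an $\varepsilon$-secure quantum tamper-detection code if the same holds with $\gamma_{M'}=\bot_{M'}$. *)

(* Defs.v *)
From HB Require Import structures.
From mathcomp Require Import all_boot all_order all_algebra.
From mathcomp Require Import reals complex.
Set Implicit Arguments. Unset Strict Implicit. Unset Printing Implicit Defensive.
Import Order.TTheory GRing.Theory Num.Theory.
Local Open Scope ring_scope.

(* Hilbert space of a share list: share i of [s] consists of [nth 0 s i]
   qubits, i.e. has computational basis 'I_(2^(nth 0 s i)).  The joint
   space of all shares has basis sharesT s = 'I_(2^s0) * ('I_(2^s1) * ... * unit). *)
Fixpoint sharesT (s : seq nat) : finType :=
  match s with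
  | [::] => unit
  | a :: s' => Finite.clone ('I_(2 ^ a) * sharesT s')%type _
  end.

Fixpoint splitLast (s : seq nat) (l : nat) : sharesT (rcons s l) -> sharesT s * 'I_(2 ^ l) :=
  match s return sharesT (rcons s l) -> sharesT s * 'I_(2 ^ l) with
  | [::] => fun x => (tt, x.1)
  | a :: s' => fun x =>
      let x' := (x : ('I_(2 ^ a) * sharesT (rcons s' l))%type) in
      let y := @splitLast s' l x'.2 in ((x'.1, y.1), y.2)
  end.

Fixpoint joinLast (s : seq nat) (l : nat) : sharesT s * 'I_(2 ^ l) -> sharesT (rcons s l) :=
  match s return sharesT s * 'I_(2 ^ l) -> sharesT (rcons s l) with
  | [::] => fun y => (y.2, tt)
  | a :: s' => fun y =>
      let y1 := (y.1 : ('I_(2 ^ a) * sharesT s')%type) in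
      ((y1.1, @joinLast s' l (y1.2, y.2)) : ('I_(2 ^ a) * sharesT (rcons s' l))%type)
  end.

Section Quantum.
Variable R : realType.
Local Notation C := (R[i]).

(* linear operators on the Hilbert space with orthonormal basis I *)
Definition sq (I : finType) := {ffun (I * I)%type -> C}.

Definition mxu (I : finType) (x y : I) : sq I :=
  [ffun ij => ((ij.1 == x) && (ij.2 == y))%:R].
Definition sqid (I : finType) : sq I := [ffun ij => (ij.1 == ij.2)%:R].
Definition sqmul (I : finType) (A B : sq I) : sq I :=
  [ffun ij => \sum_k A (ij.1, k) * B (k, ij.2)].
Definition sqadj (I : finType) (A : sq I) : sq I :=
  [ffun ij => conjc (A (ij.2, ij.1))].
Definition sqtr (I : finType) (A : sq I) : C := \sum_i A (i, i).

Definition psd (I : finType) (A : sq I) : Prop :=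
  forall v : I -> C, 0 <= \sum_i \sum_j conjc (v i) * A (i, j) * v j.
Definition is_state (I : finType) (A : sq I) : Prop := psd A /\ sqtr A = 1.

Definition tens (I J : finType) (A : sq I) (B : sq J) : sq (I * J)%type :=
  [ffun xy => A (xy.1.1, xy.2.1) * B (xy.1.2, xy.2.2)].
Definition tensmap (I1 J1 I2 J2 : finType) (F : sq I1 -> sq J1) (G : sq I2 -> sq J2)
    (X : sq (I1 * I2)%type) : sq (J1 * J2)%type :=
  \sum_(xy : ((I1 * I2) * (I1 * I2))%type)
     X xy *: tens (F (mxu xy.1.1 xy.2.1)) (G (mxu xy.1.2 xy.2.2)).
Definition tensid (I J : finType) (F : sq I -> sq J) (K : finType) :
    sq (I * K)%type -> sq (J * K)%type := tensmap F (@id (sq K)).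
Arguments tensid {I J} F K.

Definition ptr1 (I J : finType) (X : sq (I * J)%type) : sq J :=
  [ffun ab => \sum_i X ((i, ab.1), (i, ab.2))].
Definition pullback (I J : finType) (f : I -> J) (X : sq J) : sq I :=
  [ffun xy => X (f xy.1, f xy.2)].

Definition linmap (I J : finType) (F : sq I -> sq J) : Prop :=
  forall (a : C) (X Y : sq I), F (a *: X + Y) = a *: F X + F Y.
Definition cptp (I J : finType) (F : sq I -> sq J) : Prop :=
  [/\ linmap F, (forall X, sqtr (F X) = sqtr X)
    & forall (K : finType) (X : sq (I * K)%type), psd X -> psd (tensid F K X)].

(* ||X||_1 <= e, where ||X||_1 = Tr sqrt(X^* X) and sqrt(X^* X) is the
   (unique) PSD P with P P = X^* X *)
Definition trnorm_le (I : finType) (X : sq I) (e : R) : Prop :=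
  forall P : sq I, psd P -> sqmul P P = sqmul (sqadj X) X -> sqtr P <= (e%:C)%C.

(* canonical purification of sigma = S S (S = sqrt sigma, PSD):
   |psi> = (sqrt sigma (x) I) sum_i |i>|i>, returned as |psi><psi| *)
Definition pur (M : finType) (S : sq M) : sq (M * M)%type :=
  [ffun xy => S (xy.1.1, xy.1.2) * conjc (S (xy.2.1, xy.2.2))].

(* the message space H_M inside H_M (+) C|bot>, with bot = None *)
Definition embL (M K : finType) (X : sq (M * K)%type) : sq (option M * K)%type :=
  [ffun xy => match xy.1.1, xy.2.1 with
              | Some a, Some b => X ((a, xy.1.2), (b, xy.2.2))
              | _, _ => 0 end].
Definition botst (M : finType) : sq (option M) := mxu None None.

Definition is_code (M X : finType) (Enc : sq M -> sq X) (Dec : sq X -> sq (option M)) : Prop :=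
  [/\ cptp Enc, cptp Dec &
      forall (K : finType) (rho : sq (M * K)%type), is_state rho ->
        tensid (Dec \o Enc) K rho = embL rho].

Definition sec_bound (M X : finType) (eps : R) (Enc : sq M -> sq X) (Dec : sq X -> sq (option M))
    (A : sq X -> sq X) (p : R) (gam : sq (option M)) : Prop :=
  forall (sigma S : sq M), is_state sigma -> psd S -> sqmul S S = sigma ->
    let rho := pur S in
    trnorm_le (tensid (Dec \o A \o Enc) M rho
               - ((p%:C)%C *: embL rho + ((1 - p)%:C)%C *: tens gam (ptr1 rho))) eps.

Definition nm_secure (M X : finType) (cls : (sq X -> sq X) -> Prop) (eps : R)
    (Enc : sq M -> sq X) (Dec : sq X -> sq (option M)) : Prop :=
  forall A, cls A -> exists p : R, (0 <= p <= 1) /\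
    exists gam : sq (option M), is_state gam /\ sec_bound eps Enc Dec A p gam.

Definition td_secure (M X : finType) (cls : (sq X -> sq X) -> Prop) (eps : R)
    (Enc : sq M -> sq X) (Dec : sq X -> sq (option M)) : Prop :=
  forall A, cls A -> exists p : R, (0 <= p <= 1) /\
    sec_bound eps Enc Dec A p (botst M).

Fixpoint loT (s : seq nat) : Type :=
  match s with
  | [::] => unit
  | a :: s' => ((sq 'I_(2 ^ a) -> sq 'I_(2 ^ a)) * loT s')%type
  end.
Fixpoint loValid (s : seq nat) : loT s -> Prop :=
  match s return loT s -> Prop with
  | [::] => fun _ => True
  | a :: s' => fun L => cptp L.1 /\ loValid L.2
  end.
Fixpoint loApply (s : seq nat) : loT s -> sq (sharesT s) -> sq (sharesT s) :=
  match s return loT s -> sq (sharesT s) -> sq (sharesT s) with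
  | [::] => fun _ X => X
  | a :: s' => fun L => tensmap L.1 (loApply L.2)
  end.
Definition LO (s : seq nat) (A : sq (sharesT s) -> sq (sharesT s)) : Prop :=
  exists L : loT s, loValid L /\ A = loApply L.

(* lambda EPR pairs on E Ehat, E = Ehat = 'I_(2^lam) (lam qubits each):
   Phi = 2^-lam sum_{a,b} |a a><b b| *)
Definition epr (d : nat) : sq ('I_d * 'I_d)%type :=
  [ffun xy => (d%:R)^-1 * ((xy.1.1 == xy.1.2) && (xy.2.1 == xy.2.2))%:R].

Definition newEnc (M : finType) (s : seq nat) (lam : nat)
    (Enct : sq (M * 'I_(2 ^ lam))%type -> sq (sharesT s)) (sigma : sq M)
    : sq (sharesT (rcons s lam)) :=
  let assoc := fun x : ((M * 'I_(2 ^ lam)) * 'I_(2 ^ lam))%type => (x.1.1, (x.1.2, x.2)) in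
  pullback (@splitLast s lam)
    (tensid Enct 'I_(2 ^ lam) (pullback assoc (tens sigma (epr (2 ^ lam))))).

(* projector I_M (x) Phi_{E' Ehat} on (H_{ME} (+) C|bot>) (x) H_Ehat *)
Definition projPhi (M : finType) (lam : nat) : sq (option (M * 'I_(2 ^ lam)) * 'I_(2 ^ lam))%type :=
  [ffun xy => match xy.1.1, xy.2.1 with
              | Some (m, e), Some (m', e') =>
                  (m == m')%:R * epr (2 ^ lam) ((e, xy.1.2), (e', xy.2.2))
              | _, _ => 0 end].

Definition accOut (M : finType) (lam : nat) (W : sq (option (M * 'I_(2 ^ lam)) * 'I_(2 ^ lam))%type)
    : sq (option M) :=
  [ffun xy => match xy.1, xy.2 with
              | Some m, Some m' => \sum_(e : 'I_(2 ^ lam)) \sum_(f : 'I_(2 ^ lam))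
                                     W ((Some (m, e), f), (Some (m', e), f))
              | _, _ => 0 end].

Definition newDec (M : finType) (s : seq nat) (lam : nat)
    (Dect : sq (sharesT s) -> sq (option (M * 'I_(2 ^ lam)))%type)
    (Y : sq (sharesT (rcons s lam))) : sq (option M) :=
  let Z := tensid Dect 'I_(2 ^ lam) (pullback (@joinLast s lam) Y) in
  let P := projPhi M lam in
  let Q := sqid _ - P in
  accOut (sqmul P (sqmul Z P)) + sqtr (sqmul Q (sqmul Z Q)) *: botst M.

End Quantum.

(* Main.v *)
Require Import Defs.
From HB Require Import structures.
From mathcomp Require Import all_boot all_order all_algebra.
From mathcomp Require Import reals complex spectral sesquilinear ring lra.
Import Order.TTheory GRing.Theory Num.Theory.
Local Open Scope ring_scope.
Set Implicit Arguments. Unset Strict Implicit. Unset Printing Implicit Defensive.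

(* Given [A = Lam_1 (x) ... (x) Lam_(t+1)], apply the non-malleability of the
   inner code to [Lam_1 (x) ... (x) Lam_t] and to the message
   [sigma (x) I/2^lam], whose canonical purification is
   [sigma_(M Mhat) (x) Phi_(E Ehat)]; its reference register contains the last
   share.  Tampering with that share and then measuring [E' Ehat] is a channel,
   so it does not increase the trace norm, and it remains to look at the two
   ideal outcomes.  On [sigma (x) Phi] it gives a mixture of [sigma] and [bot]
   of weight [q = <Phi|Lam_(t+1)(Phi)|Phi>], which depends on [A] only.
   On [gamma (x) sigma_Mhat (x) I/2^lam] the measurement accepts with
   probability [2^-lam tr (gamma_E Lam_(t+1)(I/2^lam)^T) <= 2^-lam], hence the
   outcome is within [2 * 2^-lam] of [bot]. *)

(** * Operators and channels *)

Section Operators.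
Variable R : realType.
Local Notation C := (R[i]).
Implicit Types I J K A B : finType.

(** Contractivity of the trace norm is never stated as such. [trnorm_le] speaks of square roots of
    [X^* X], so the inner security error is diagonalised once and split as [Xp - Xm], positive parts
    of total trace at most [eps]. A channel keeps the positivity and the trace of each part, and a
    difference of positive operators is bounded by their total trace. The splitting needs a
    Hermitian error, which holds because encoding, tampering and decoding preserve Hermiticity. The
    second ideal outcome differs from [bot] by [D - r bot] (tensored with the reference marginal),
    where [tr D = r <= 2^-lam]. Its two terms join the two positive parts and each adds at most [r],
    which is the origin of [2 * 2^-lam = 2^(1-lam)]. Purified messages are treated through their
    blocks in the reference register. Such blocks need not be positive, so the identities for
    decoding and measuring are proved for arbitrary operators. *)

Lemma sqP I (X Y : sq R I) : (forall i j, X (i, j) = Y (i, j)) -> X = Y.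
Proof. by move=> h; apply/ffunP=> -[i j]. Qed.

Lemma mxuE I (x y i j : I) : mxu R x y (i, j) = ((i == x) && (j == y))%:R.
Proof. by rewrite ffunE. Qed.

Lemma sqaddE I (X Y : sq R I) ij : (X + Y) ij = X ij + Y ij.
Proof. by rewrite ffunE. Qed.

Lemma sqsubE I (X Y : sq R I) ij : (X - Y) ij = X ij - Y ij.
Proof. by rewrite !ffunE. Qed.

Lemma sqscaleE I (a : C) (X : sq R I) ij : (a *: X) ij = a * X ij.
Proof. by rewrite ffunE. Qed.

Lemma conjc_ge0 (z : C) : 0 <= z * conjc z.
Proof. exact: mul_conjC_ge0. Qed.

Lemma conjc_ge0_id (z : C) : 0 <= z -> conjc z = z.
Proof. by case: z => x y; rewrite lecE => /andP[/eqP /= -> _]; rewrite oppr0. Qed.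

Lemma sum_pair I J (f : I * J -> C) : \sum_p f p = \sum_i \sum_j f (i, j).
Proof. by rewrite pair_bigA /=; apply: eq_bigr => -[]. Qed.

Lemma sum_option I (f : option I -> C) : \sum_x f x = f None + \sum_i f (Some i).
Proof.
rewrite (bigD1 None) //=; congr (_ + _).
rewrite (reindex_omap Some id) /=; last by case.
by apply: eq_bigl => i; rewrite eqxx.
Qed.

Lemma sum_delta I (j : I) (f : I -> C) : \sum_i (i == j)%:R * f i = f j.
Proof.
rewrite (bigD1 j) //= eqxx mul1r big1 ?addr0 // => i /negbTE ->.
by rewrite mul0r.
Qed.

Lemma sum_deltar I (j : I) (f : I -> C) : \sum_i f i * (i == j)%:R = f j.
Proof. by under eq_bigr do rewrite mulrC; apply: sum_delta. Qed.

Lemma sqmulE I (X Y : sq R I) i j : sqmul X Y (i, j) = \sum_k X (i, k) * Y (k, j).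
Proof. by rewrite ffunE. Qed.

Lemma sqidE I (i j : I) : sqid R I (i, j) = (i == j)%:R.
Proof. by rewrite ffunE. Qed.

Lemma sqtrD I (X Y : sq R I) : sqtr (X + Y) = sqtr X + sqtr Y.
Proof. by rewrite -big_split; apply: eq_bigr => i _; rewrite sqaddE. Qed.

Lemma sqtrZ I a (X : sq R I) : sqtr (a *: X) = a * sqtr X.
Proof. by rewrite /sqtr big_distrr; apply: eq_bigr => i _; rewrite sqscaleE. Qed.

Lemma sq_decomp I (X : sq R I) : X = \sum_(xy : I * I) X xy *: mxu R xy.1 xy.2.
Proof.
apply: sqP => i j; rewrite sum_ffunE.
under eq_bigr => xy _ do rewrite sqscaleE mxuE eq_sym (eq_sym j).
rewrite -(sum_deltar (i, j) (fun xy => X xy)).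
by apply: eq_bigr => -[x y] _ /=; rewrite xpair_eqE.
Qed.

Section Linear.
Variables (I J : finType) (F : sq R I -> sq R J).
Hypothesis linF : linmap F.

Lemma linmap0 : F 0 = 0.
Proof. by have := linF (-1) 0 0; rewrite scaler0 addr0 scaleN1r addNr. Qed.

Lemma linmapD X Y : F (X + Y) = F X + F Y.
Proof. by have := linF 1 X Y; rewrite !scale1r. Qed.

Lemma linmapZ a X : F (a *: X) = a *: F X.
Proof. by have := linF a X 0; rewrite linmap0 !addr0. Qed.

Lemma linmapB X Y : F (X - Y) = F X - F Y.
Proof. by rewrite -(scaleN1r Y) -(scaleN1r (F Y)) linmapD linmapZ. Qed.

Lemma linmap_sum A (X : A -> sq R I) : F (\sum_a X a) = \sum_a F (X a).
Proof. exact: (big_morph _ linmapD linmap0). Qed.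

Lemma linmapE X ij :
  F X ij = \sum_x \sum_y X (x, y) * F (mxu R x y) ij.
Proof.
rewrite {1}(sq_decomp X) linmap_sum sum_ffunE pair_bigA /=.
by apply: eq_bigr => -[x y] _; rewrite linmapZ sqscaleE.
Qed.
End Linear.

(** * Tensor products of maps, block by block *)

Lemma linmap_comp I J K (F : sq R I -> sq R J) (G : sq R J -> sq R K) :
  linmap F -> linmap G -> linmap (G \o F).
Proof. by move=> lF lG a X Y /=; rewrite lF lG. Qed.

Definition blk I K (X : sq R (I * K)%type) (k k' : K) : sq R I :=
  [ffun ij => X ((ij.1, k), (ij.2, k'))].

Lemma blkE I K (X : sq R (I * K)%type) k k' i j :
  blk X k k' (i, j) = X ((i, k), (j, k')).
Proof. by rewrite ffunE. Qed.

Lemma tensE I J (X : sq R I) (Y : sq R J) i j i' j' :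
  tens X Y ((i, j), (i', j')) = X (i, i') * Y (j, j').
Proof. by rewrite ffunE. Qed.

Lemma pullbackE I J (f : I -> J) (X : sq R J) i j :
  pullback f X (i, j) = X (f i, f j).
Proof. by rewrite ffunE. Qed.

Section Tensmap.
Variables (I1 J1 I2 J2 : finType).
Implicit Types (F : sq R I1 -> sq R J1) (G : sq R I2 -> sq R J2).

Lemma tensmap_sumE F G X j1 j2 j1' j2' :
  tensmap F G X ((j1, j2), (j1', j2')) =
  \sum_x2 \sum_y2 \sum_x1 \sum_y1 X ((x1, x2), (y1, y2)) *
     (F (mxu R x1 y1) (j1, j1') * G (mxu R x2 y2) (j2, j2')).
Proof.
rewrite /tensmap sum_ffunE.
under [RHS]eq_bigr do rewrite exchange_big /=.
rewrite exchange_big /= pair_bigA /= .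
under [RHS]eq_bigr do rewrite exchange_big /= pair_bigA /=.
rewrite pair_bigA /=.
by apply: eq_bigr => -[[x1 x2] [y1 y2]] _ /=; rewrite sqscaleE tensE.
Qed.

Lemma tensmap_mxuE F G x y j j' :
  tensmap F G (mxu R x y) (j, j') =
  F (mxu R x.1 y.1) (j.1, j'.1) * G (mxu R x.2 y.2) (j.2, j'.2).
Proof.
case: x y j j' => [x1 x2] [y1 y2] [j1 j2] [j1' j2'].
rewrite tensmap_sumE /=.
rewrite -(sum_delta x2 (fun a => _ * G (mxu R a y2) _)).
apply: eq_bigr => a2 _.
rewrite -(sum_delta y2 (fun b => _ * G (mxu R a2 b) _)) big_distrr.
apply: eq_bigr => b2 _ /=.
rewrite -(sum_delta x1 (fun a => F (mxu R a y1) _)) big_distrl !big_distrr.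
apply: eq_bigr => a1 _ /=.
rewrite -(sum_delta y1 (fun b => F (mxu R a1 b) _)).
rewrite big_distrr big_distrl !big_distrr.
apply: eq_bigr => b1 _ /=.
rewrite mxuE !xpair_eqE !mulrA; congr (_ * _ * _).
by case: (a1 == _); case: (b1 == _); case: (a2 == _); case: (b2 == _);
  rewrite /= ?(mulr0, mul0r, mulr1, mul1r).
Qed.

(** Both factors are evaluated on matrix units; linearity of [F] reassembles the first index pair
    into a block of [X] and leaves [G] on units. *)
Lemma tensmapE F G X j1 j2 j1' j2' : linmap F ->
  tensmap F G X ((j1, j2), (j1', j2')) =
  \sum_x2 \sum_y2 F (blk X x2 y2) (j1, j1') * G (mxu R x2 y2) (j2, j2').
Proof.
move=> linF; rewrite tensmap_sumE; apply: eq_bigr => x2 _; apply: eq_bigr => y2 _.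
rewrite (linmapE linF) big_distrl /=; apply: eq_bigr => x1 _; rewrite big_distrl.
by apply: eq_bigr => y1 _; rewrite blkE mulrA.
Qed.

Lemma linmap_tensmap F G : linmap (tensmap F G).
Proof.
move=> a X Y; apply: sqP => -[j1 j2] [j1' j2'].
rewrite sqaddE sqscaleE !tensmap_sumE big_distrr -big_split.
apply: eq_bigr => x2 _; rewrite /= big_distrr -big_split.
apply: eq_bigr => y2 _; rewrite /= big_distrr -big_split.
apply: eq_bigr => x1 _; rewrite /= big_distrr -big_split.
by apply: eq_bigr => y1 _; rewrite /= sqaddE sqscaleE mulrDl -mulrA.
Qed.
End Tensmap.

Lemma tensidE I J K (F : sq R I -> sq R J) (linF : linmap F) (X : sq R (I * K)%type) j k j' k' :
  tensid F X ((j, k), (j', k')) = F (blk X k k') (j, j').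
Proof.
rewrite /tensid tensmapE //.
rewrite -(sum_deltar k (fun a => F (blk X a k') _)).
apply: eq_bigr => a _.
rewrite -(sum_deltar k' (fun b => F (blk X a b) _)) big_distrl /=.
apply: eq_bigr => b _; rewrite mxuE -mulrA; congr (_ * _).
by rewrite eq_sym (eq_sym k'); case: (a == k); case: (b == k'); rewrite /= ?(mulr0, mulr1).
Qed.

Lemma blk_tensid I J K (F : sq R I -> sq R J) (X : sq R (I * K)%type) k k' :
  linmap F -> blk (tensid F X) k k' = F (blk X k k').
Proof. by move=> linF; apply: sqP => i j; rewrite blkE tensidE. Qed.

Lemma linmap_tensid I J K (F : sq R I -> sq R J) : linmap (@tensid R I J F K).
Proof. exact: linmap_tensmap. Qed.

Lemma tensid_comp I J L K (F : sq R I -> sq R J) (G : sq R J -> sq R L)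
    (X : sq R (I * K)%type) : linmap F -> linmap G ->
  tensid (G \o F) X = tensid G (tensid F X).
Proof.
move=> lF lG; apply: sqP => -[i k] [j l].
by rewrite !tensidE ?blk_tensid //; apply: linmap_comp.
Qed.

Lemma tensid_tensmap I J L I2 J2 (F : sq R I -> sq R J) (H : sq R J -> sq R L)
    (G : sq R I2 -> sq R J2) X : linmap F -> linmap H ->
  tensid H (tensmap F G X) = tensmap (H \o F) G X.
Proof.
move=> lF lH; apply: sqP => -[i k] [j l].
rewrite tensidE // tensmapE; last exact: linmap_comp.
have -> : blk (tensmap F G X) k l =
    \sum_x \sum_y G (mxu R x y) (k, l) *: F (blk X x y).
  apply: sqP => a b; rewrite blkE tensmapE // sum_ffunE; apply: eq_bigr => x _.
  by rewrite sum_ffunE; apply: eq_bigr => y _; rewrite sqscaleE mulrC.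
rewrite linmap_sum // sum_ffunE; apply: eq_bigr => x _.
rewrite linmap_sum // sum_ffunE; apply: eq_bigr => y _.
by rewrite linmapZ // sqscaleE mulrC.
Qed.

Lemma tensmap_tensid I J L I2 J2 (F : sq R I -> sq R J) (H : sq R J -> sq R L)
    (G : sq R I2 -> sq R J2) X : linmap F -> linmap H ->
  tensmap H G (tensid F X) = tensmap (H \o F) G X.
Proof.
move=> lF lH; apply: sqP => -[i k] [j l].
rewrite !tensmapE //; last exact: linmap_comp.
by do 2![apply: eq_bigr => ? _]; rewrite blk_tensid.
Qed.

Lemma sqtr_tens I J (X : sq R I) (Y : sq R J) : sqtr (tens X Y) = sqtr X * sqtr Y.
Proof.
rewrite /sqtr sum_pair big_distrl; apply: eq_bigr => i _; rewrite big_distrr.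
by apply: eq_bigr => j _; rewrite tensE.
Qed.

(** * Quadratic forms, positivity and Hermiticity *)

Definition qf I (X : sq R I) (v : I -> C) : C :=
  \sum_i \sum_j conjc (v i) * X (i, j) * v j.

Lemma psd0 I : psd (0 : sq R I).
Proof. by move=> v; rewrite big1 // => i _; rewrite big1 // => j _; rewrite ffunE mulr0 mul0r. Qed.

Lemma psdD I (X Y : sq R I) : psd X -> psd Y -> psd (X + Y).
Proof.
move=> pX pY v; have := addr_ge0 (pX v) (pY v); rewrite -big_split /=.
congr (0 <= _); apply: eq_bigr => i _; rewrite -big_split; apply: eq_bigr => j _.
by rewrite /= sqaddE mulrDr mulrDl.
Qed.

Lemma qfZ I a (X : sq R I) v : qf (a *: X) v = a * qf X v.
Proof.
rewrite /qf big_distrr; apply: eq_bigr => i _; rewrite /= big_distrr.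
by apply: eq_bigr => j _; rewrite /= sqscaleE; ring.
Qed.

Lemma psdZ I a (X : sq R I) : 0 <= a -> psd X -> psd (a *: X).
Proof. by move=> a0 pX v; have := mulr_ge0 a0 (pX v); rewrite -/(qf X v) -qfZ. Qed.

Lemma qfD I (X Y : sq R I) v : qf (X + Y) v = qf X v + qf Y v.
Proof.
rewrite -big_split; apply: eq_bigr => i _; rewrite -big_split; apply: eq_bigr => j _.
by rewrite /= sqaddE mulrDr mulrDl.
Qed.

Lemma qfB I (X Y : sq R I) v : qf (X - Y) v = qf X v - qf Y v.
Proof. by rewrite -(scaleN1r Y) qfD qfZ mulN1r. Qed.

Lemma qf_delta I (X : sq R I) k : qf X (fun i => (i == k)%:R) = X (k, k).
Proof.
rewrite /qf -[RHS](sum_delta k (fun i => X (i, k))); apply: eq_bigr => i _.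
rewrite -[X (i, k)](sum_deltar k (fun j => X (i, j))) big_distrr.
by apply: eq_bigr => j _; rewrite /= conjc_nat mulrA.
Qed.

Lemma psd_diag_ge0 I (X : sq R I) k : psd X -> 0 <= X (k, k).
Proof. by move=> pX; rewrite -qf_delta; apply: pX. Qed.

Lemma psd_sqtr_ge0 I (X : sq R I) : psd X -> 0 <= sqtr X.
Proof. by move=> pX; apply: sumr_ge0 => i _; apply: psd_diag_ge0. Qed.

Lemma qf_two I (X : sq R I) k l (a b : C) :
  qf X (fun i => a * (i == k)%:R + b * (i == l)%:R) =
  conjc a * a * X (k, k) + conjc a * b * X (k, l) + conjc b * a * X (l, k)
  + conjc b * b * X (l, l).
Proof.
have inner i : \sum_j X (i, j) * (a * (j == k)%:R + b * (j == l)%:R)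
    = a * X (i, k) + b * X (i, l).
  rewrite -[X (i, k)](sum_deltar k (fun j => X (i, j))).
  rewrite -[X (i, l)](sum_deltar l (fun j => X (i, j))).
  rewrite !big_distrr -big_split; apply: eq_bigr => j _ /=.
  by rewrite mulrDr !mulrA (mulrC _ a) (mulrC _ b).
transitivity (conjc a * (a * X (k, k) + b * X (k, l))
            + conjc b * (a * X (l, k) + b * X (l, l))).
  rewrite -[a * X (k, k) + _](sum_delta k (fun i => a * X (i, k) + b * X (i, l))).
  rewrite -[a * X (l, k) + _](sum_delta l (fun i => a * X (i, k) + b * X (i, l))).
  rewrite !big_distrr -big_split /=; apply: eq_bigr => i _.
  rewrite -inner !big_distrr -big_split /=; apply: eq_bigr => j _.
  rewrite rmorphD !rmorphM /= !conjc_nat.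
  by rewrite !mulrDl !mulrA.
by rewrite !mulrDr !mulrA !addrA.
Qed.

Lemma Im_ge0 (z : C) : 0 <= z -> complex.Im z = 0.
Proof. by case: z => x y; rewrite lecE => /andP[/eqP -> _]. Qed.

Definition herm I (X : sq R I) : Prop := forall i j, X (j, i) = conjc (X (i, j)).

(** A non-negative complex number is real. Reality of the form at [e_i], [e_j], [e_i + e_j] and
    [e_i + i e_j] fixes the imaginary and real parts of the two off-diagonal entries against each
    other. *)
Lemma psd_herm I (X : sq R I) : psd X -> herm X.
Proof.
move=> pX i j.
have real_diag k : complex.Im (X (k, k)) = 0.
  exact/Im_ge0/psd_diag_ge0.
have r a b : complex.Im (qf X (fun k => a * (k == i)%:R + b * (k == j)%:R)) = 0.
  exact/Im_ge0/pX.
have := r 1 1; have := r 1 'i%C; rewrite !qf_two.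
move: (real_diag i) (real_diag j).
case: (X (i, i)) => ? ?; case: (X (j, j)) => ? ?.
case: (X (i, j)) => xr xi; case: (X (j, i)) => yr yi /= -> ->.
simpc => /= h1 h2.
by apply/eqP; rewrite eq_complex /=; apply/andP; split; apply/eqP; lra.
Qed.

Lemma hermD I (X Y : sq R I) : herm X -> herm Y -> herm (X + Y).
Proof. by move=> hX hY i j; rewrite !sqaddE hX hY rmorphD. Qed.

Lemma hermZ I (a : R) (X : sq R I) : herm X -> herm ((a%:C)%C *: X).
Proof. by move=> hX i j; rewrite !sqscaleE hX rmorphM /= oppr0. Qed.

Lemma hermB I (X Y : sq R I) : herm X -> herm Y -> herm (X - Y).
Proof. by move=> hX hY i j; rewrite !sqsubE hX hY rmorphB. Qed.

(** * Kraus form and complete positivity *)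

Definition kraus A I J (V : A -> J -> I -> C) (X : sq R I) : sq R J :=
  [ffun jj => \sum_a \sum_x \sum_y V a jj.1 x * X (x, y) * conjc (V a jj.2 y)].

Lemma krausE A I J (V : A -> J -> I -> C) X j j' :
  kraus V X (j, j') = \sum_a \sum_x \sum_y V a j x * X (x, y) * conjc (V a j' y).
Proof. by rewrite ffunE. Qed.

Lemma qf_kraus A I J (V : A -> J -> I -> C) X v :
  qf (kraus V X) v = \sum_a qf X (fun x => \sum_j conjc (V a j x) * v j).
Proof.
rewrite /qf; under eq_bigr => j _.
  under eq_bigr => j' _.
    rewrite krausE big_distrr big_distrl /=; over.
  rewrite exchange_big /=; over.
rewrite exchange_big /=; apply: eq_bigr => a _.
under eq_bigr => j _.
  under eq_bigr => j' _.
    rewrite big_distrr big_distrl /=; over.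
  rewrite exchange_big /=; over.
rewrite exchange_big /=; apply: eq_bigr => x _.
under eq_bigr => j _.
  under eq_bigr => j' _.
    rewrite big_distrr big_distrl /=; over.
  rewrite exchange_big /=; over.
rewrite exchange_big /=; apply: eq_bigr => y _.
rewrite rmorph_sum /= !big_distrl /=; apply: eq_bigr => j _.
rewrite big_distrr /=; apply: eq_bigr => j' _.
by rewrite rmorphM /= conjcK; ring.
Qed.

Lemma psd_kraus A I J (V : A -> J -> I -> C) X : psd X -> psd (kraus V X).
Proof. by move=> pX v; rewrite -/(qf _ v) qf_kraus; apply: sumr_ge0 => a _; apply: pX. Qed.

Lemma linmap_kraus A I J (V : A -> J -> I -> C) : linmap (kraus V).
Proof.
move=> a X Y; apply: sqP => j j'; rewrite sqaddE sqscaleE !krausE.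
do 3![rewrite big_distrr -big_split /=; apply: eq_bigr => ? _].
by rewrite sqaddE sqscaleE; ring.
Qed.

Lemma tensid_kraus A I J K (V : A -> J -> I -> C) (X : sq R (I * K)%type) :
  tensid (kraus V) X = kraus (fun a jk xk => V a jk.1 xk.1 * (xk.2 == jk.2)%:R) X.
Proof.
apply: sqP => -[j k] [j' k']; rewrite tensidE ?krausE; last exact: linmap_kraus.
apply: eq_bigr => a _.
rewrite sum_pair; apply: eq_bigr => x _.
rewrite -(sum_deltar k (fun l => \sum_y V a j x * blk X l k' (x, y) * conjc (V a j' y))).
apply: eq_bigr => l _; rewrite sum_pair big_distrl; apply: eq_bigr => y _ /=.
rewrite -(sum_deltar k' (fun m => V a j x * blk X l m (x, y) * conjc (V a j' y))).
rewrite big_distrl; apply: eq_bigr => m _ /=.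
by rewrite blkE rmorphM /= conjc_nat; ring.
Qed.

(** [cptp] is split in two because general pullbacks and the single branches of the measurement are
    completely positive without preserving the trace. *)
Definition cp I J (F : sq R I -> sq R J) : Prop :=
  linmap F /\ forall K (X : sq R (I * K)%type), psd X -> psd (tensid F X).

Definition tp I J (F : sq R I -> sq R J) : Prop := forall X, sqtr (F X) = sqtr X.

Lemma cptpP I J (F : sq R I -> sq R J) : cptp F <-> cp F /\ tp F.
Proof. by split=> [[]|[[]]]. Qed.

Lemma cp_kraus A I J (V : A -> J -> I -> C) : cp (kraus V).
Proof.
split=> [|K X pX]; first exact: linmap_kraus.
by rewrite tensid_kraus; apply: psd_kraus.
Qed.

Lemma eq_tensid I J K (F G : sq R I -> sq R J) (X : sq R (I * K)%type) :
  F =1 G -> tensid F X = tensid G X.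
Proof. by move=> e; rewrite /tensid /tensmap; apply: eq_bigr => ? _; rewrite e. Qed.

Lemma eq_cp I J (F G : sq R I -> sq R J) : F =1 G -> cp F -> cp G.
Proof.
move=> e [l p]; split=> [a X Y|K X pX]; first by rewrite -!e l.
by rewrite -(eq_tensid _ e); apply: p.
Qed.

Lemma cp_comp I J K (F : sq R I -> sq R J) (G : sq R J -> sq R K) :
  cp F -> cp G -> cp (G \o F).
Proof.
move=> [lF pF] [lG pG]; split=> [|L X pX]; first exact: linmap_comp.
by rewrite tensid_comp //; apply/pG/pF.
Qed.

Lemma cp_add I J (F G : sq R I -> sq R J) : cp F -> cp G -> cp (fun X => F X + G X).
Proof.
move=> [lF pF] [lG pG].
have l : linmap (fun X => F X + G X).
  by move=> a X Y; rewrite lF lG scalerDr addrACA.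
split; first exact: l.
move=> L X pX.
have -> : tensid (fun X => F X + G X) X = tensid F X + tensid G X.
  by apply: sqP => -[j k] [j' k']; rewrite [LHS](tensidE l) [LHS]sqaddE [RHS]sqaddE;
    congr (_ + _); apply/esym/tensidE.
by apply: psdD; [apply: pF | apply: pG].
Qed.

(** One Kraus operator suffices. Pullbacks serve both as permutations of registers and, for
    injective [f], as compressions to a diagonal block. *)
Lemma pullback_kraus I J (f : I -> J) (X : sq R J) :
  pullback f X = kraus (fun (_ : unit) i j => (j == f i)%:R) X.
Proof.
apply: sqP => i i'; rewrite pullbackE krausE (big_pred1 tt) => [|[]//].
rewrite -(sum_delta (f i) (fun x => X (x, f i'))); apply: eq_bigr => x _.
rewrite -[X (x, _)](sum_deltar (f i') (fun y => X (x, y))) big_distrr.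
by apply: eq_bigr => y _ /=; rewrite conjc_nat mulrA.
Qed.

Lemma cp_pullback I J (f : I -> J) : cp (@pullback R I J f).
Proof.
by apply: eq_cp (cp_kraus (fun (_ : unit) i j => (j == f i)%:R)) => X; rewrite pullback_kraus.
Qed.

Lemma psd_pullback I J (f : I -> J) (X : sq R J) : psd X -> psd (pullback f X).
Proof. by move=> pX; rewrite pullback_kraus; apply: psd_kraus. Qed.

(** Complete positivity with the one-dimensional reference [unit], which is attached and removed by
    pullbacks. *)
Lemma cp_psd I J (F : sq R I -> sq R J) X : cp F -> psd X -> psd (F X).
Proof.
move=> [l p] pX.
have := psd_pullback (fun j => (j, tt)) (p unit (pullback fst X) (psd_pullback _ pX)).
congr psd; apply: sqP => j j'; rewrite pullbackE tensidE //; congr (F _ _).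
by apply: sqP => i i'; rewrite blkE pullbackE.
Qed.

Lemma cp_tensid I J K (F : sq R I -> sq R J) : cp F -> cp (@tensid R I J F K).
Proof.
move=> [l p]; split=> [|L X pX]; first exact: linmap_tensid.
pose ra (x : I * (K * L)) := ((x.1, x.2.1), x.2.2).
have := psd_pullback (fun x : (J * K) * L => (x.1.1, (x.1.2, x.2)))
           (p _ _ (psd_pullback ra pX)).
congr psd; apply: sqP => -[[j k] m] [[j' k'] m'].
rewrite pullbackE !tensidE //; last exact: linmap_tensid.
by congr (F _ _); apply: sqP => i i'; rewrite !blkE pullbackE.
Qed.

Lemma sqtr_tensid I J K (F : sq R I -> sq R J) (X : sq R (I * K)%type) :
  linmap F -> tp F -> sqtr (tensid F X) = sqtr X.
Proof.
move=> lF tF; rewrite /sqtr !sum_pair exchange_big [RHS]exchange_big /=.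
apply: eq_bigr => k _; have := tF (blk X k k); rewrite /sqtr.
under [X in _ = X -> _]eq_bigr do rewrite blkE.
by move=> <-; apply: eq_bigr => j _; rewrite tensidE.
Qed.

Lemma tensmap_swap I1 J1 I2 J2 (F : sq R I1 -> sq R J1) (G : sq R I2 -> sq R J2) X :
  tensmap F G X = pullback (fun j => (j.2, j.1))
     (tensmap G F (pullback (fun x : I2 * I1 => (x.2, x.1)) X)).
Proof.
apply: sqP => -[j1 j2] [j1' j2']; rewrite pullbackE /= !tensmap_sumE.
under eq_bigr do rewrite exchange_big /=.
rewrite exchange_big /=; apply: eq_bigr => x1 _.
under eq_bigr do rewrite exchange_big /=.
rewrite exchange_big /=; apply: eq_bigr => y1 _.
do 2![apply: eq_bigr => ? _]; rewrite pullbackE /=; congr (_ * _).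
exact: mulrC.
Qed.

Lemma cp_idtens I J K (G : sq R I -> sq R J) : cp G ->
  cp (tensmap (@id (sq R K)) G).
Proof.
move=> cG.
apply: (@eq_cp _ _ (pullback (fun j : K * J => (j.2, j.1)) \o
    (@tensid R I J G K \o pullback (fun x : I * K => (x.2, x.1))))) => [X|].
  by rewrite tensmap_swap.
by do 2?apply: cp_comp; [apply: cp_pullback | apply: cp_tensid | apply: cp_pullback].
Qed.

Lemma sqtr_pullback_bij I J (f : I -> J) (X : sq R J) :
  bijective f -> sqtr (pullback f X) = sqtr X.
Proof.
move=> [g fK gK]; rewrite /sqtr [RHS](reindex f) /=; last by exists g => ? _.
by apply: eq_bigr => i _; rewrite pullbackE.
Qed.

Lemma tp_idtens I J K (G : sq R I -> sq R J) : linmap G -> tp G ->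
  tp (tensmap (@id (sq R K)) G).
Proof.
move=> lG tG X; rewrite tensmap_swap sqtr_pullback_bij; last first.
  by exists (fun j => (j.2, j.1)) => -[].
rewrite [LHS]sqtr_tensid // sqtr_pullback_bij //.
by exists (fun j => (j.2, j.1)) => -[].
Qed.

(** Sum of the rank-one operators of the vectors [V a]; explicit operators are shown positive by
    writing them in this form. *)
Definition gram A I (V : A -> I -> C) : sq R I :=
  [ffun ij => \sum_a V a ij.1 * conjc (V a ij.2)].

Lemma gramE A I (V : A -> I -> C) i j :
  gram V (i, j) = \sum_a V a i * conjc (V a j).
Proof. by rewrite ffunE. Qed.

(** Tensoring with a sum of rank-one operators is a Kraus map with one operator per vector, so
    positivity of such products is a case of [psd_kraus]. *)
Lemma tens_gram A I K (V : A -> K -> C) (X : sq R I) :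
  tens X (gram V) = kraus (fun a ik x => (x == ik.1)%:R * V a ik.2) X.
Proof.
apply: sqP => -[i k] [i' k']; rewrite tensE gramE krausE big_distrr.
apply: eq_bigr => a _ /=.
rewrite -(sum_delta i (fun x => X (x, i'))) big_distrl; apply: eq_bigr => x _ /=.
rewrite -[X (x, _)](sum_deltar i' (fun y => X (x, y))) big_distrr big_distrl.
by apply: eq_bigr => y _ /=; rewrite rmorphM /= conjc_nat; ring.
Qed.

Lemma psd_tens_gram A I K (V : A -> K -> C) (X : sq R I) : psd X -> psd (tens X (gram V)).
Proof. by move=> pX; rewrite tens_gram; apply: psd_kraus. Qed.

Lemma psd_gram A I (V : A -> I -> C) : psd (gram V).
Proof.
have p1 : psd (sqid R unit).
  move=> v; rewrite !(big_pred1 tt) => [|[]//|[]//].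
  by rewrite ffunE mulr1 mulrC conjc_ge0.
have := psd_pullback (fun i => (tt, i)) (psd_tens_gram V p1).
by congr psd; apply: sqP => i j; rewrite pullbackE tensE ffunE /= mul1r.
Qed.

Lemma sqid_gram I : sqid R I = gram (fun a i : I => (i == a)%:R).
Proof.
apply: sqP => i j; rewrite gramE sqidE -[LHS](sum_delta i (fun a => (a == j)%:R)).
by apply: eq_bigr => a _; rewrite conjc_nat (eq_sym a) (eq_sym a).
Qed.

Lemma psd_sqid I : psd (sqid R I).
Proof. by rewrite sqid_gram; apply: psd_gram. Qed.

Lemma sqtr_sqid I : sqtr (sqid R I) = #|I|%:R.
Proof. by rewrite /sqtr (eq_bigr (fun=> 1)) ?sumr_const // => i _; rewrite sqidE eqxx. Qed.

Lemma purE I (T : sq R I) a b a' b' :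
  pur T ((a, b), (a', b')) = T (a, b) * conjc (T (a', b')).
Proof. by rewrite ffunE. Qed.

Lemma ptr1E I J (X : sq R (I * J)%type) j j' :
  ptr1 X (j, j') = \sum_i X ((i, j), (i, j')).
Proof. by rewrite ffunE. Qed.

(** Serves, with [psd_tens_gram], to make a positive operator tensored with the reference marginal
    positive. *)
Lemma ptr1_pur_gram I (T : sq R I) :
  ptr1 (pur T) = gram (fun m mh => T (m, mh)).
Proof. by apply: sqP => i j; rewrite ptr1E gramE; apply: eq_bigr => m _; rewrite purE. Qed.

Lemma psd_pur I (T : sq R I) : psd (pur T).
Proof.
have -> : pur T = gram (fun (_ : unit) xy => T xy).
  by apply: sqP => -[i j] [i' j']; rewrite gramE (big_pred1 tt) ?purE // => -[].
exact: psd_gram.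
Qed.

Lemma sqtr_ptr1_pur I (T : sq R I) : psd T ->
  sqtr (ptr1 (pur T)) = sqtr (sqmul T T).
Proof.
move=> pT; rewrite /sqtr; under eq_bigr do rewrite ptr1E.
rewrite exchange_big; apply: eq_bigr => i _ /=; rewrite sqmulE.
by apply: eq_bigr => j _; rewrite purE (psd_herm pT i j).
Qed.

(** Unnormalised maximally entangled operator. Its blocks are the matrix units, so
    [tensid F (maxent I)] is the Choi operator of [F]. *)
Definition maxent I : sq R (I * I)%type :=
  gram (fun (_ : unit) (xy : I * I) => (xy.1 == xy.2)%:R).

Lemma blk_maxent I (x y : I) : blk (maxent I) x y = mxu R x y.
Proof.
apply: sqP => i i'; rewrite blkE gramE (big_pred1 tt) => [|[]//].
by rewrite conjc_nat mxuE /= -natrM mulnb.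
Qed.

(* [F] commutes with the adjoint, expressed on matrix units. *)
Definition kherm I J (F : sq R I -> sq R J) : Prop :=
  forall x y j j', F (mxu R y x) (j', j) = conjc (F (mxu R x y) (j, j')).

(** The Choi operator of [F] is positive, hence Hermitian, and its entries are those of [F] on
    matrix units. *)
Lemma cptp_kherm I J (F : sq R I -> sq R J) : cptp F -> kherm F.
Proof.
move=> [l _ p] x y j j'.
have := psd_herm (p _ _ (psd_gram _ : psd (maxent I))) (j, x) (j', y).
by rewrite !tensidE // !blk_maxent.
Qed.

(** * Spectral theorem and trace norm *)

Definition spec I A (u : A -> I -> C) (f : A -> C) : sq R I :=
  [ffun ab => \sum_k f k * (u k ab.1 * conjc (u k ab.2))].

Lemma specE I A (u : A -> I -> C) f a b :
  spec u f (a, b) = \sum_k f k * (u k a * conjc (u k b)).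
Proof. by rewrite ffunE. Qed.

(** Orthonormality drives the calculus of [spec]; completeness turns traces into sums of
    [qf X (u k)]. *)
Lemma herm_spectral I (X : sq R I) : herm X ->
  exists u : 'I_#|I| -> I -> C, exists d : 'I_#|I| -> C,
  [/\ X = spec u d, forall k, d k \is Num.real,
      forall k l, \sum_a conjc (u k a) * u l a = (k == l)%:R
    & forall a b, \sum_k u k a * conjc (u k b) = (a == b)%:R].
Proof.
move=> hX; pose M := \matrix_(i < #|I|, j < #|I|) X (enum_val i, enum_val j).
have hM : M \is hermsymmx.
  apply/is_hermitianmxP; rewrite expr0 scale1r; apply/matrixP => i j.
  by rewrite !mxE hX.
have /orthomx_spectralP := hermitian_normalmx hM.
have /mxOverP dR := hermitian_spectral_diag_real hM.
have uP := spectral_unitarymx M.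
rewrite invmx_unitary //; set P := spectralmx M in uP *; set d := spectral_diag M in dR *.
move=> eM; have := uP; rewrite -trmxC_unitary => /unitarymxP; rewrite trmxCK => PP'.
move/unitarymxP: uP => PP.
(* From [M = P^* diag(d) P], the eigenvectors are the conjugated rows of [P]. *)
exists (fun k a => conjc (P k (enum_rank a))), (fun k => d 0 k); split=> [|k|k l|a b].
- apply: sqP => a b; rewrite specE.
  have -> : X (a, b) = M (enum_rank a) (enum_rank b) by rewrite mxE !enum_rankK.
  rewrite eM mxE; apply: eq_bigr => k _; rewrite mul_mx_diag !mxE conjcK.
  by rewrite -mulrA mulrCA.
- exact: dR.
- move/matrixP: PP => /(_ k l); rewrite !mxE => <-.
  rewrite (reindex _ (onW_bij _ (enum_val_bij I))) /=.
  by apply: eq_bigr => i _; rewrite enum_valK conjcK !mxE.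
- move/matrixP: PP' => /(_ (enum_rank a) (enum_rank b)).
  rewrite !mxE (inj_eq enum_rank_inj) => <-.
  by apply: eq_bigr => i _; rewrite conjcK !mxE.
Qed.

Lemma sum_qf_basis I A (u : A -> I -> C) (X : sq R I) :
  (forall a b, \sum_k u k a * conjc (u k b) = (a == b)%:R) ->
  \sum_k qf X (u k) = sqtr X.
Proof.
move=> uP; rewrite exchange_big; apply: eq_bigr => i _ /=.
rewrite exchange_big -(sum_deltar i (fun j => X (i, j))); apply: eq_bigr => j _ /=.
by rewrite -uP big_distrr; apply: eq_bigr => k _ /=; ring.
Qed.

Lemma qf_spec I A (u : A -> I -> C) f v :
  qf (spec u f) v =
  \sum_k f k * ((\sum_i conjc (v i) * u k i) * conjc (\sum_i conjc (v i) * u k i)).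
Proof.
rewrite /qf; under eq_bigr => i _.
  under eq_bigr => j _ do rewrite specE big_distrr big_distrl /=.
  rewrite exchange_big /=; over.
rewrite exchange_big /=; apply: eq_bigr => k _.
rewrite big_distrl big_distrr /=; apply: eq_bigr => i _.
rewrite rmorph_sum !big_distrr /=; apply: eq_bigr => j _.
by rewrite rmorphM /= conjcK; ring.
Qed.

Lemma psd_spec I A (u : A -> I -> C) f : (forall k, 0 <= f k) -> psd (spec u f).
Proof.
move=> f0 v; rewrite -/(qf _ v) qf_spec; apply: sumr_ge0 => k _.
exact/mulr_ge0/conjc_ge0.
Qed.

Section Orthonormal.
Variables (I A : finType) (u : A -> I -> C).
Hypothesis uP : forall k l, \sum_a conjc (u k a) * u l a = (k == l)%:R.

Lemma qf_spec_basis f k : qf (spec u f) (u k) = f k.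
Proof.
rewrite qf_spec -[RHS](sum_delta k f); apply: eq_bigr => l _.
by rewrite uP conjc_nat -natrM mulnb andbb eq_sym mulrC.
Qed.

Lemma sqtr_spec f : sqtr (spec u f) = \sum_k f k.
Proof.
rewrite /sqtr; under eq_bigr do rewrite specE.
rewrite exchange_big; apply: eq_bigr => k _ /=.
rewrite -big_distrr /= -[RHS]mulr1; congr (_ * _).
transitivity (\sum_a conjc (u k a) * u k a); last by rewrite uP eqxx.
by apply: eq_bigr => i _; rewrite mulrC.
Qed.

Lemma sqmul_spec f g : sqmul (spec u f) (spec u g) = spec u (fun k => f k * g k).
Proof.
apply: sqP => a b; rewrite ffunE specE /=.
under eq_bigr => i _.
  rewrite !specE big_distrl /=.
  under eq_bigr => k _ do rewrite big_distrr /=.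
  over.
rewrite exchange_big; apply: eq_bigr => k _ /=.
rewrite exchange_big -[RHS](sum_delta k (fun l => f k * g l * (u k a * conjc (u l b)))).
apply: eq_bigr => l _ /=; rewrite eq_sym -uP big_distrl; apply: eq_bigr => i _ /=.
by ring.
Qed.
End Orthonormal.

Lemma sqadj_herm I (X : sq R I) : herm X -> sqadj X = X.
Proof. by move=> hX; apply: sqP => i j; rewrite ffunE -hX. Qed.

Lemma trnorm_split I (X : sq R I) (e : R) : herm X -> trnorm_le X e ->
  exists Xp Xm : sq R I,
  [/\ psd Xp, psd Xm, X = Xp - Xm & sqtr Xp + sqtr Xm <= (e%:C)%C].
Proof.
move=> hX; have [u [d [eX dR uP uQ]]] := herm_spectral hX.
(* The norm bound is tested at the positive square root [|X|] of [X^* X]. *)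
move=> /(_ (spec u (fun k => `|d k|))) H.
have h2 (x : C) : 0 <= x -> 0 <= x / 2 by move=> x0; rewrite divr_ge0 // ler0n.
exists (spec u (fun k => (`|d k| + d k) / 2)), (spec u (fun k => (`|d k| - d k) / 2)).
split.
- by apply: psd_spec => k; apply: h2; rewrite -lerBlDr sub0r -normrN real_ler_norm ?rpredN.
- by apply: psd_spec => k; apply: h2; rewrite subr_ge0 real_ler_norm.
- rewrite eX; apply: sqP => a b; rewrite sqsubE !specE -sumrB; apply: eq_bigr => k _.
  by rewrite -mulrBl; congr (_ * _); field.
- rewrite !sqtr_spec // -big_split /= .
  have avg (x y : C) : (x + y) / 2 + (x - y) / 2 = x by field.
  under eq_bigr => k _ do rewrite avg.
  rewrite -(sqtr_spec uP); apply: H; first exact: psd_spec.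
  rewrite sqadj_herm // !eX !sqmul_spec //.
  by apply: sqP => a b; rewrite !specE; apply: eq_bigr => k _;
    rewrite -!expr2 real_normK.
Qed.

Lemma qf_id I v : qf (sqid R I) v = \sum_i conjc (v i) * v i.
Proof.
apply: eq_bigr => i _; rewrite -[X in _ = _ * X](sum_delta i v) big_distrr.
by apply: eq_bigr => j _; rewrite /= sqidE eq_sym mulrA.
Qed.

Lemma qf_sqmul_ge0 I (X : sq R I) v : herm X -> 0 <= qf (sqmul X X) v.
Proof.
move=> hX; have -> : qf (sqmul X X) v =
    \sum_k conjc (\sum_i X (k, i) * v i) * (\sum_i X (k, i) * v i).
  rewrite /qf; under eq_bigr => i _.
    under eq_bigr => j _ do rewrite sqmulE big_distrr big_distrl /=.
    rewrite exchange_big /=; over.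
  rewrite exchange_big; apply: eq_bigr => k _ /=.
  rewrite rmorph_sum big_distrl; apply: eq_bigr => i _ /=; rewrite big_distrr.
  by apply: eq_bigr => j _; rewrite /= rmorphM (hX k i) /=; ring.
by apply: sumr_ge0 => k _; rewrite mulrC conjc_ge0.
Qed.

Lemma sqmul_subid I (X : sq R I) c :
  sqmul (X - c *: sqid R I) (X - c *: sqid R I) =
  sqmul X X - (2 * c) *: X + c ^+ 2 *: sqid R I.
Proof.
apply: sqP => i j; rewrite sqaddE sqsubE !sqscaleE !sqmulE sqidE.
have e1 : \sum_k X (i, k) * (k == j)%:R = X (i, j) by rewrite sum_deltar.
have e2 : \sum_k (k == i)%:R * X (k, j) = X (i, j) by rewrite sum_delta.
have e3 : \sum_k (k == i)%:R * (k == j)%:R = (i == j)%:R :> C by rewrite sum_delta.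
transitivity (\sum_k X (i, k) * X (k, j) - c * (\sum_k X (i, k) * (k == j)%:R)
  - c * (\sum_k (k == i)%:R * X (k, j)) + c ^+ 2 * (\sum_k (k == i)%:R * (k == j)%:R)).
  rewrite !big_distrr -!sumrB -big_split; apply: eq_bigr => k _.
  by rewrite /= !sqsubE !sqscaleE !sqidE (eq_sym i); ring.
by rewrite e1 e2 e3; ring.
Qed.

(* In an eigenbasis [u_k] of [Y = Yp - Ym], with eigenvalues [d_k], positivity of
   [<u_k, (P - c)^2 u_k>] at [c = <u_k, P u_k>] reads [c^2 <= d_k^2], so
   [tr P <= sum_k |d_k|]. *)
Lemma trnorm_bound I (Yp Ym : sq R I) (e : R) : psd Yp -> psd Ym ->
  sqtr Yp + sqtr Ym <= (e%:C)%C -> trnorm_le (Yp - Ym) e.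
Proof.
move=> pp pm le_e P pP; set Y := Yp - Ym.
have hY : herm Y.
  by move=> i j; rewrite !sqsubE (psd_herm pp i) (psd_herm pm i) -rmorphB.
rewrite sqadj_herm //; have [u [d [eY dR uP uQ]]] := herm_spectral hY.
rewrite eY sqmul_spec // => PP.
apply: le_trans le_e; rewrite -!(sum_qf_basis _ uQ) -big_split.
apply: ler_sum => k _ /=.
set c := qf P (u k); have c0 : 0 <= c by apply: pP.
have dk : d k = qf Yp (u k) - qf Ym (u k).
  by rewrite -qfB -/Y eY qf_spec_basis.
apply: (@le_trans _ _ `|d k|); last first.
  by rewrite dk; apply: le_trans (ler_normB _ _) _; rewrite !ger0_norm; [exact: lexx|exact: pm|exact: pp].
rewrite -(@ler_pXn2r _ 2) ?nnegrE // real_normK // -subr_ge0.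
have hB : herm (P - c *: sqid R I).
  move=> i j; rewrite !sqsubE !sqscaleE !sqidE (psd_herm pP i) rmorphB rmorphM /= conjc_nat eq_sym.
  by rewrite (conjc_ge0_id c0).
have := qf_sqmul_ge0 (u k) hB.
rewrite sqmul_subid PP qfD qfB !qfZ qf_spec_basis // qf_id uP eqxx -/c.
by congr (0 <= _); rewrite -[true%:R]/(1 : C); ring.
Qed.

(** The left side is the trace of [X] times the transpose of [Y], whence the conjugated eigenvectors
    of [Y]. The expectation of a positive [X] in one vector of an orthonormal basis is at most its
    trace. *)
Lemma sum_mul_psd_le I (X Y : sq R I) : psd X -> psd Y ->
  \sum_i \sum_j X (i, j) * Y (i, j) <= sqtr X * sqtr Y.
Proof.
move=> pX pY; have [u [d [eY dR uP uQ]]] := herm_spectral (psd_herm pY).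
have d0 k : 0 <= d k by rewrite -(qf_spec_basis uP d k) -eY; apply: pY.
have uQ' a b : \sum_k (conjc (u k a)) * conjc (conjc (u k b)) = (a == b)%:R.
  by rewrite eq_sym -uQ; apply: eq_bigr => k _; rewrite conjcK mulrC.
rewrite {2}eY sqtr_spec // big_distrr /=.
suff -> : \sum_i \sum_j X (i, j) * Y (i, j) =
    \sum_k qf X (fun i => conjc (u k i)) * d k.
  apply: ler_sum => k _; apply: ler_wpM2r => //.
  rewrite -(sum_qf_basis _ uQ') (bigD1 k) //= lerDl.
  by apply: sumr_ge0 => l _; apply: pX.
under [RHS]eq_bigr => k _.
  rewrite big_distrl; under eq_bigr do rewrite big_distrl /=.
  over.
rewrite [RHS]exchange_big; apply: eq_bigr => i _ /=.
rewrite [RHS]exchange_big; apply: eq_bigr => j _ /=.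
rewrite eY specE big_distrr; apply: eq_bigr => k _ /=; rewrite conjcK; ring.
Qed.

End Operators.

(** * The EPR measurement *)

Section Measurement.
Variables (R : realType) (M : finType) (lam : nat).
Local Notation C := (R[i]).
Local Notation E := 'I_(2 ^ lam).
Local Notation OE := (option (M * E) * E)%type.
Local Notation dim := ((2 ^ lam)%:R : C).
Local Notation P := (projPhi R M lam).
Implicit Types (W : sq R OE) (S : sq R M) (omega : sq R (E * E)%type).

Definition emb S : sq R (option M) :=
  [ffun xy => match xy.1, xy.2 with Some a, Some b => S (a, b) | _, _ => 0 end].

(** The partial expectation [<Phi|W|Phi>] over [E' Ehat]: a closed form of the accepting branch. *)
Definition acc W : sq R (option M) :=
  [ffun xy => match xy.1, xy.2 with
    | Some m, Some m' =>
        dim^-1 * \sum_g \sum_h W ((Some (m, g), g), (Some (m', h), h))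
    | _, _ => 0 end].

Definition meas W : sq R (option M) :=
  let Q := sqid R _ - P in
  accOut (sqmul P (sqmul W P)) + sqtr (sqmul Q (sqmul W Q)) *: botst R M.

Lemma dim_neq0 : dim != 0.
Proof. by rewrite pnatr_eq0 -lt0n expn_gt0. Qed.

Lemma sum_OE (f : OE -> C) :
  \sum_k f k = \sum_f0 f (None, f0) + \sum_m \sum_e \sum_f0 f (Some (m, e), f0).
Proof. by rewrite sum_pair sum_option sum_pair. Qed.

Lemma eprE (e f e' f' : E) :
  epr R (2 ^ lam) ((e, f), (e', f')) = dim^-1 * ((e == f) && (e' == f'))%:R.
Proof. by rewrite ffunE. Qed.

Lemma projPhi_sym k l : P (k, l) = P (l, k).
Proof.
rewrite !ffunE /=; case: k l => [[[m e]|] f] [[[m' e']|] f'] //=.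
by rewrite !eprE eq_sym andbC.
Qed.

Lemma conjc_dimV : conjc (dim^-1) = dim^-1.
Proof. by rewrite conjc_inv conjc_nat. Qed.

Lemma projPhi_real k l : conjc (P (k, l)) = P (k, l).
Proof.
rewrite !ffunE; case: k l => [[[m e]|] f] [[[m' e']|] f']; try exact: conjc0.
by rewrite /= !eprE !rmorphM /= !conjc_nat conjc_dimV.
Qed.

Lemma sum_projPhi m e f (g : OE -> C) :
  \sum_k P ((Some (m, e), f), k) * g k =
  dim^-1 * (e == f)%:R * \sum_h g (Some (m, h), h).
Proof.
rewrite sum_OE big1 ?add0r => [|f' _]; last by rewrite ffunE /= mul0r.
rewrite (bigD1 m) //= [X in _ + X]big1 ?addr0 => [|m' /negbTE nm]; last first.
  by do 2![rewrite big1 // => ? _]; rewrite ffunE /= eq_sym nm !mul0r.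
rewrite big_distrr; apply: eq_bigr => e' _ /=.
rewrite -[g (Some (m, e'), e')](sum_delta e' (fun h => g (Some (m, e'), h))) big_distrr.
apply: eq_bigr => f' _; rewrite /= ffunE /= eqxx mul1r eprE (eq_sym f').
by case: (e == f); case: (e' == f'); rewrite /= ?(mulr0, mulr1, mul0r, mul1r).
Qed.

Lemma sum_projPhi_None f (g : OE -> C) : \sum_k P ((None, f), k) * g k = 0.
Proof. by rewrite big1 // => k _; rewrite ffunE /= mul0r. Qed.

Lemma projPhi_idem : sqmul P P = P.
Proof.
apply: sqP => -[[[m e]|] f] l; rewrite sqmulE; last first.
  by rewrite sum_projPhi_None ffunE.
rewrite sum_projPhi; case: l => -[[m' e']|] f'; last first.
  by rewrite big1 ?mulr0 ?ffunE // => h _; rewrite ffunE.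
under eq_bigr do rewrite ffunE /= eprE eqxx andTb.
rewrite sumr_const card_ord -[X in _ * X]mulr_natl ffunE /= eprE.
rewrite -mulnb natrM; set a := (m == m')%:R; set b := (e == f)%:R; set c := (e' == f')%:R.
transitivity (dim * dim^-1 * (a * (dim^-1 * (b * c)))); first by ring.
by rewrite mulfV ?mul1r // dim_neq0.
Qed.

Lemma accOut_projPhi W : accOut (sqmul P (sqmul W P)) = acc W.
Proof.
apply: sqP => -[m|] [m'|]; rewrite !ffunE //=.
(* Each of the two projectors contributes [dim^-1]; tracing over the pairs with [e = f] gives back
   one factor [dim]. *)
transitivity (\sum_(e : E) \sum_(f : E) dim^-1 ^+ 2 * (e == f)%:R *
    \sum_g \sum_h W ((Some (m, g), g), (Some (m', h), h))).
  apply: eq_bigr => e _; apply: eq_bigr => f _; rewrite sqmulE sum_projPhi.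
  under eq_bigr => g _.
    rewrite sqmulE; under eq_bigr do rewrite mulrC projPhi_sym.
    rewrite sum_projPhi; over.
  rewrite -mulr_sumr /= !mulrA; congr (_ * _).
  by case: (e == f); rewrite /= ?(mulr0, mul0r, mulr1).
set T := \sum_g \sum_h W ((Some (m, g), g), (Some (m', h), h)).
transitivity (\sum_(e : E) dim^-1 ^+ 2 * T).
  apply: eq_bigr => e _; rewrite -mulr_suml -mulr_sumr; congr (_ * _).
  rewrite -[RHS]mulr1; congr (_ * _).
  by rewrite -[RHS](sum_delta e (fun=> 1)); apply: eq_bigr => ? _; rewrite eq_sym mulr1.
by rewrite sumr_const card_ord -[LHS]mulr_natl expr2 !mulrA mulfV ?dim_neq0 // mul1r.
Qed.

Lemma sqtr_acc W : sqtr (acc W) = \sum_k \sum_l P (k, l) * W (k, l).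
Proof.
rewrite /sqtr sum_option ffunE /= add0r [RHS]sum_OE [X in _ = X + _]big1 ?add0r => [|f _]; last first.
  exact: sum_projPhi_None.
apply: eq_bigr => m _; rewrite ffunE /= big_distrr; apply: eq_bigr => e _ /=.
under [RHS]eq_bigr do rewrite sum_projPhi mulrAC eq_sym.
by rewrite sum_deltar.
Qed.

(** [Q = I - P] is idempotent, so by cyclicity the trace of [Q W Q] is that of [W] minus that of
    [P W], and the latter is [sqtr (acc W)]. *)
Lemma sqtr_reject W : sqtr (sqmul (sqid R _ - P) (sqmul W (sqid R _ - P))) =
  sqtr W - sqtr (acc W).
Proof.
have QQ l k : \sum_x (sqid R _ - P) (l, x) * (sqid R _ - P) (x, k) = (sqid R _ - P) (l, k).
  transitivity (\sum_x ((x == l)%:R * (x == k)%:R) - \sum_x (x == l)%:R * P (x, k)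
     - \sum_x P (l, x) * (x == k)%:R + \sum_x P (l, x) * P (x, k)).
    rewrite -!sumrB -big_split; apply: eq_bigr => x _ /=.
    by rewrite !sqsubE !sqidE (eq_sym l); ring.
  rewrite !sum_delta sum_deltar -sqmulE projPhi_idem sqsubE sqidE; ring.
transitivity (\sum_k \sum_l W (k, l) * (sqid R _ - P) (l, k)).
  rewrite /sqtr; under eq_bigr => x _.
    rewrite sqmulE; under eq_bigr => k _ do rewrite sqmulE big_distrr /=.
    over.
  rewrite exchange_big; apply: eq_bigr => k _ /=.
  rewrite exchange_big; apply: eq_bigr => l _ /=.
  by rewrite -QQ big_distrr; apply: eq_bigr => x _ /=; ring.
rewrite sqtr_acc /sqtr -sumrB; apply: eq_bigr => k _.
rewrite -[W (k, k)](sum_deltar k (fun l => W (k, l))) -sumrB.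
by apply: eq_bigr => l _; rewrite sqsubE sqidE (projPhi_sym k); ring.
Qed.

Lemma measE W : meas W = acc W + (sqtr W - sqtr (acc W)) *: botst R M.
Proof. by rewrite /meas accOut_projPhi sqtr_reject. Qed.

Lemma sqtr_botst : sqtr (botst R M) = 1.
Proof. by rewrite /sqtr sum_option mxuE big1 ?addr0 // => i _; rewrite mxuE. Qed.

Lemma tp_meas : tp meas.
Proof. by move=> W; rewrite measE sqtrD sqtrZ sqtr_botst mulr1 addrC subrK. Qed.

(** Tracing out [E' Ehat] gives one Kraus operator per basis vector [(e, f)], with zero row at
    [None]. *)
Lemma acc_kraus W : accOut (sqmul P (sqmul W P)) =
  kraus (fun (ef : E * E) o k =>
     if o is Some m then P ((Some (m, ef.1), ef.2), k) else 0) W.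
Proof.
apply: sqP => -[m|] [m'|]; rewrite krausE ffunE /=; last 3 first.
- by rewrite big1 // => ef _; rewrite big1 // => k _; rewrite big1 // => l _; rewrite oppr0; exact: mulr0.
- by rewrite big1 // => ef _; rewrite big1 // => k _; rewrite big1 // => l _; rewrite !mul0r.
- by rewrite big1 // => ef _; rewrite big1 // => k _; rewrite big1 // => l _; rewrite !mul0r.
rewrite sum_pair; apply: eq_bigr => e _; apply: eq_bigr => f _ /=.
rewrite sqmulE; apply: eq_bigr => k _; rewrite sqmulE big_distrr; apply: eq_bigr => l _ /=.
by rewrite projPhi_real (projPhi_sym l) mulrA.
Qed.

Lemma reject_kraus W :
  sqtr (sqmul (sqid R _ - P) (sqmul W (sqid R _ - P))) *: botst R M =
  kraus (fun (a : OE) (o : option M) k => (o == None)%:R * (sqid R _ - P) (a, k)) W.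
Proof.
apply: sqP => o o'; rewrite krausE sqscaleE mxuE /sqtr big_distrl; apply: eq_bigr => a _.
rewrite sqmulE big_distrl; apply: eq_bigr => k _ /=.
rewrite sqmulE big_distrr big_distrl; apply: eq_bigr => l _ /=.
rewrite rmorphM /= conjc_nat !sqsubE rmorphB /= projPhi_real (projPhi_sym l) !sqidE conjc_nat.
by rewrite (eq_sym l) -mulnb natrM; ring.
Qed.

Lemma cp_meas : cp meas.
Proof.
apply: eq_cp (cp_add (cp_kraus (fun (ef : E * E) o k =>
     if o is Some m then P ((Some (m, ef.1), ef.2), k) else 0))
  (cp_kraus (fun (a : OE) (o : option M) k => (o == None)%:R * (sqid R _ - P) (a, k)))) => W.
by rewrite -acc_kraus -reject_kraus.
Qed.

Lemma psd_acc W : psd W -> psd (acc W).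
Proof. by move=> pW; rewrite -accOut_projPhi acc_kraus; apply: psd_kraus. Qed.

(** The [None] diagonal entry of [meas W] is exactly the trace missing from [acc W]. *)
Lemma sqtr_acc_le W : psd W -> sqtr (acc W) <= sqtr W.
Proof.
move=> pW; rewrite -subr_ge0; have := psd_diag_ge0 None (cp_psd cp_meas pW).
by rewrite measE sqaddE ffunE /= add0r sqscaleE mxuE mulr1.
Qed.

Definition fid omega : C := dim^-1 * \sum_g \sum_h omega ((g, g), (h, h)).

Lemma sqtr_emb S : sqtr (emb S) = sqtr S.
Proof. by rewrite /sqtr sum_option ffunE add0r; apply: eq_bigr => m _; rewrite ffunE. Qed.

(** * Product inputs to the measurement *)

Section Product.
Variables (W : sq R OE) (S : sq R M) (omega : sq R (E * E)%type).
Hypothesis WE : forall m e f m' e' f', W ((Some (m, e), f), (Some (m', e'), f')) =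
  S (m, m') * omega ((e, f), (e', f')).
Hypothesis WN : forall f k, W ((None, f), k) = 0.

Lemma acc_prod : acc W = fid omega *: emb S.
Proof.
apply: sqP => -[m|] [m'|]; rewrite sqscaleE !ffunE /= ?mulr0 //.
rewrite /fid -mulrA; congr (_ * _); rewrite big_distrl; apply: eq_bigr => g _ /=.
by rewrite big_distrl; apply: eq_bigr => h _ /=; rewrite WE mulrC.
Qed.

Lemma sqtr_prod : sqtr W = sqtr S * sqtr omega.
Proof.
rewrite /sqtr sum_OE big1 ?add0r => [|f _]; last exact: WN.
rewrite big_distrl; apply: eq_bigr => m _ /=; rewrite sum_pair big_distrr.
apply: eq_bigr => e _ /=; rewrite big_distrr.
by apply: eq_bigr => f _; rewrite WE.
Qed.

(** [S] is an arbitrary operator, as the lemma is applied to off-diagonal blocks of a purification;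
    hence the factor [sqtr S] in the weight of [bot]. *)
Lemma meas_prod :
  meas W = fid omega *: emb S + (sqtr S * (sqtr omega - fid omega)) *: botst R M.
Proof.
rewrite measE acc_prod sqtrZ sqtr_emb sqtr_prod; congr (_ + _ *: _).
by rewrite mulrBr [fid _ * _]mulrC.
Qed.
End Product.

Lemma fid_ge0 omega : psd omega -> 0 <= fid omega.
Proof.
move=> /(_ (fun ef => (ef.1 == ef.2)%:R)) p; apply: mulr_ge0; first by rewrite invr_ge0 ler0n.
move: p; congr (0 <= _); rewrite sum_pair; apply: eq_bigr => e _.
rewrite -[RHS](sum_delta e (fun f => \sum_h omega ((e, f), (h, h)))); apply: eq_bigr => f _ /=.
rewrite conjc_nat eq_sym sum_pair big_distrr; apply: eq_bigr => e' _ /=.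
rewrite -[omega _ in RHS](sum_delta e' (fun f' => omega ((e, f), (e', f')))) big_distrr.
by apply: eq_bigr => f' _ /=; rewrite (eq_sym e'); ring.
Qed.

Lemma fid_le_sqtr omega : (0 < #|M|)%N -> psd omega -> fid omega <= sqtr omega.
Proof.
case/card_gt0P => m0 _ p.
(* Padding [omega] with a basis state [m0] of the message turns the claim into [sqtr_acc_le]; this
   is where [M] must be inhabited. *)
pose W : sq R OE := kraus (fun (_ : unit) (k : OE) ef =>
   if k is (Some (m, e), f) then (m == m0)%:R * (ef == (e, f))%:R else 0) omega.
have WE m e f m' e' f' : W ((Some (m, e), f), (Some (m', e'), f')) =
    mxu R m0 m0 (m, m') * omega ((e, f), (e', f')).
  rewrite krausE (big_pred1 tt) => [|[]//].
  rewrite mxuE -mulnb natrM -[omega _](sum_delta (e, f) (fun x => omega (x, (e', f')))).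
  rewrite big_distrr; apply: eq_bigr => x _ /=.
  rewrite -[omega (x, _)](sum_deltar (e', f') (fun y => omega (x, y))) !big_distrr.
  by apply: eq_bigr => y _ /=; rewrite rmorphM /= !conjc_nat; ring.
have WN f k : W ((None, f), k) = 0.
  by rewrite krausE; do 3![rewrite big1 // => ? _]; rewrite !mul0r.
have := sqtr_acc_le (psd_kraus _ p : psd W).
rewrite (acc_prod WE) (sqtr_prod WE WN) sqtrZ sqtr_emb.
have -> : sqtr (mxu R m0 m0) = 1.
  rewrite /sqtr -[RHS](sum_delta m0 (fun=> 1)); apply: eq_bigr => m _.
  by rewrite mxuE andbb mulr1.
by rewrite mulr1 mul1r.
Qed.

End Measurement.

(** * Local operations and the extended code *)

Section LocalOperations.
Variable R : realType.
Local Notation C := (R[i]).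
Implicit Types I J K A B : finType.

Lemma kherm_tensmap I1 J1 I2 J2 (F : sq R I1 -> sq R J1) (G : sq R I2 -> sq R J2) :
  kherm F -> kherm G -> kherm (tensmap F G).
Proof.
move=> hF hG x y j j'; rewrite [LHS]tensmap_mxuE [X in conjc X]tensmap_mxuE rmorphM /=.
by congr (_ * _).
Qed.

Lemma kherm_id I : kherm (@id (sq R I)).
Proof. by move=> x y j j'; rewrite !mxuE conjc_nat andbC. Qed.

Lemma kherm_herm I J (F : sq R I -> sq R J) X : linmap F -> kherm F -> herm X -> herm (F X).
Proof.
move=> lF hF hX i j; rewrite !(linmapE lF) exchange_big rmorph_sum; apply: eq_bigr => x _ /=.
rewrite rmorph_sum; apply: eq_bigr => y _ /=.
by rewrite (hX x y) (hF x y) -rmorphM.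
Qed.

Lemma herm_tensid I J K (F : sq R I -> sq R J) (X : sq R (I * K)%type) :
  linmap F -> kherm F -> herm X -> herm (tensid F X).
Proof.
move=> lF hF; apply: kherm_herm; first exact: linmap_tensid.
exact/kherm_tensmap/kherm_id.
Qed.

Lemma linmap_loApply s (L : loT R s) : linmap (loApply L).
Proof. by case: s L => [|a s] L; [|apply: linmap_tensmap]. Qed.

(** Used to make the inner security error Hermitian. On matrix units a tensor product of maps is a
    product of entries, so the property passes through the recursion. *)
Lemma kherm_loApply s (L : loT R s) : loValid L -> kherm (loApply L).
Proof.
elim: s L => [|a s IH] L; first by move=> _; apply: kherm_id.
by case=> /cptp_kherm h /IH; apply: kherm_tensmap.
Qed.

Fixpoint loInit s l : loT R (rcons s l) -> loT R s :=
  match s return loT R (rcons s l) -> loT R s with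
  | [::] => fun _ => tt
  | a :: s' => fun L => (L.1, loInit L.2)
  end.

Fixpoint loLast s l : loT R (rcons s l) -> sq R 'I_(2 ^ l) -> sq R 'I_(2 ^ l) :=
  match s return loT R (rcons s l) -> sq R 'I_(2 ^ l) -> sq R 'I_(2 ^ l) with
  | [::] => fun L => L.1
  | a :: s' => fun L => loLast L.2
  end.

Lemma loValid_rcons s l (L : loT R (rcons s l)) :
  loValid L -> loValid (loInit L) /\ cptp (loLast L).
Proof.
elim: s L => [|a s IH] L /=; first by case.
by case=> h /IH [].
Qed.

Lemma splitLastK s l : cancel (@splitLast s l) (@joinLast s l).
Proof. by elim: s => [[x []]|a s IH [x y]] //=; congr (_, _); rewrite -[RHS]IH; case: splitLast. Qed.

Lemma joinLastK s l : cancel (@joinLast s l) (@splitLast s l).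
Proof. by elim: s => [[[] x]|a s IH [[x y] z]] //=; rewrite IH. Qed.

Lemma loApply_rcons_mxu s l (L : loT R (rcons s l)) x y j j' :
  loApply L (mxu R x y) (j, j') =
  tensmap (loApply (loInit L)) (loLast L) (mxu R (splitLast x) (splitLast y))
    (splitLast j, splitLast j').
Proof.
rewrite tensmap_mxuE; elim: s L x y j j' => [|a s IH] L x y j j'.
  case: x y j j' => [x []] [y []] [j []] [j' []] /=.
  by rewrite tensmap_mxuE /= !mxuE mulr1 mul1r.
case: x y j j' => [x1 x2] [y1 y2] [j1 j2] [j1' j2'] /=.
by rewrite !tensmap_mxuE /= IH mulrA.
Qed.

(** In the right-nested [sharesT] the last share sits innermost. After regrouping, the attack is
    bipartite: the first shares against the last one. *)
Lemma loApply_rcons s l (L : loT R (rcons s l)) W :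
  pullback (@joinLast s l) (loApply L (pullback (@splitLast s l) W)) =
  tensmap (loApply (loInit L)) (loLast L) W.
Proof.
apply: sqP => k k'; rewrite pullbackE (linmapE (linmap_loApply L)).
rewrite (linmapE (linmap_tensmap _ _)) (reindex (@joinLast s l)) /=; last first.
  by apply: onW_bij; exists (@splitLast s l); [exact: joinLastK | exact: splitLastK].
apply: eq_bigr => a _; rewrite (reindex (@joinLast s l)) /=; last first.
  by apply: onW_bij; exists (@splitLast s l); [exact: joinLastK | exact: splitLastK].
by apply: eq_bigr => b _; rewrite pullbackE loApply_rcons_mxu !joinLastK.
Qed.

(** Correctness is given on states with a reference. The normalised maximally entangled state
    carries all matrix units as blocks, and linearity does the rest. *)
Lemma dec_enc_emb (M X : finType) (Enc : sq R M -> sq R X) (Dec : sq R X -> sq R (option M)) :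
  is_code Enc Dec -> forall S, Dec (Enc S) = emb S.
Proof.
move=> [[lE _ _] [lD _ _] code] S.
have lDE := linmap_comp lE lD.
have lemb : linmap (@emb R M).
  by move=> a Y Z; apply: sqP => -[m|] [m'|]; rewrite sqaddE sqscaleE !ffunE /= ?mulr0 ?addr0 // sqaddE sqscaleE.
suff mxu_emb x y : Dec (Enc (mxu R x y)) = emb (mxu R x y).
  apply: sqP => i j; rewrite (linmapE lemb) -[LHS]/((Dec \o Enc) S (i, j)) (linmapE lDE).
  by do 2![apply: eq_bigr => ? _]; rewrite /= mxu_emb.
have M0 : (#|M|%:R : C) != 0 by rewrite pnatr_eq0 -lt0n; apply/card_gt0P; exists x.
have stW : is_state (#|M|%:R^-1 *: maxent R M).
  split; first by apply: psdZ; [rewrite invr_ge0 ler0n | exact: psd_gram].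
  rewrite sqtrZ /sqtr sum_pair exchange_big.
  rewrite (eq_bigr (fun _ => 1)) ?sumr_const ?mulVf // => a _.
  rewrite -[RHS](sum_delta a (fun=> 1)); apply: eq_bigr => b _.
  by rewrite -blkE blk_maxent mxuE andbb mulr1.
have := code M _ stW; rewrite linmapZ; last exact: linmap_tensid.
move=> /(congr1 (fun Z => #|M|%:R *: Z)); rewrite scalerA mulfV // scale1r => eW.
apply: sqP => o o'.
have -> : Dec (Enc (mxu R x y)) (o, o') = tensid (Dec \o Enc) (maxent R M) ((o, x), (o', y)).
  by rewrite (tensidE lDE) blk_maxent.
rewrite eW sqscaleE !ffunE /=; case: o o' => [m|] [m'|]; rewrite ?mulr0 //.
by rewrite sqscaleE mulrA mulfV // mul1r -blkE blk_maxent.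
Qed.

End LocalOperations.

(** * Correctness of the extended code *)

Section Construction.
Variables (R : realType) (M : finType) (s : seq nat) (lam : nat).
Local Notation C := (R[i]).
Local Notation E := 'I_(2 ^ lam).
Local Notation dim := ((2 ^ lam)%:R : C).
Local Notation Phi := (epr R (2 ^ lam)).
Variables (Enct : sq R (M * E)%type -> sq R (sharesT s))
          (Dect : sq R (sharesT s) -> sq R (option (M * E))).

Definition addEpr (S : sq R M) : sq R ((M * E) * E)%type :=
  pullback (fun x => (x.1.1, (x.1.2, x.2))) (tens S Phi).

(** [dim] copies of one vector with amplitudes [dim^-1] replace a single vector with amplitude
    [dim^(-1/2)], so no square root appears. *)
Lemma epr_gram : Phi = gram (fun (_ : E) (ef : E * E) => dim^-1 * (ef.1 == ef.2)%:R).
Proof.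
apply: sqP => -[e f] [e' f']; rewrite gramE eprE sumr_const card_ord -[RHS]mulr_natl.
rewrite rmorphM /= conjc_nat (conjc_dimV R lam) -mulnb natrM.
transitivity (dim * dim^-1 * (dim^-1 * ((e == f)%:R * (e' == f')%:R))); last by ring.
by rewrite mulfV ?mul1r // dim_neq0.
Qed.

Lemma psd_epr : psd Phi.
Proof. by rewrite epr_gram; apply: psd_gram. Qed.

Lemma fid_epr : fid Phi = 1.
Proof.
rewrite /fid (eq_bigr (fun=> 1)) => [|g _].
  by rewrite sumr_const card_ord mulVf // dim_neq0.
under eq_bigr do rewrite eprE !eqxx mulr1.
by rewrite sumr_const card_ord -[LHS]mulr_natl mulfV // dim_neq0.
Qed.

Lemma sqtr_epr : sqtr Phi = 1.
Proof.
rewrite /sqtr sum_pair (eq_bigr (fun=> dim^-1)) => [|e _].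
  by rewrite sumr_const card_ord -[LHS]mulr_natl mulfV // dim_neq0.
rewrite -[RHS](sum_delta e (fun=> dim^-1)); apply: eq_bigr => f _.
by rewrite eprE andbb mulrC eq_sym.
Qed.

Lemma addEprE S m e f m' e' f' :
  addEpr S (((m, e), f), ((m', e'), f')) = S (m, m') * Phi ((e, f), (e', f')).
Proof. by rewrite pullbackE tensE. Qed.

Lemma cp_addEpr : cp addEpr.
Proof.
apply: (@eq_cp _ _ _ (pullback (fun x : (M * E) * E => (x.1.1, (x.1.2, x.2))) \o
  kraus (fun (a : E) (ik : M * (E * E)) x =>
    (x == ik.1)%:R * (dim^-1 * (ik.2.1 == ik.2.2)%:R)))) => [S|].
  by rewrite /addEpr epr_gram tens_gram.
by apply: cp_comp; [apply: cp_kraus | apply: cp_pullback].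
Qed.

Lemma tp_addEpr : tp addEpr.
Proof.
move=> S; rewrite /addEpr sqtr_pullback_bij ?sqtr_tens ?sqtr_epr ?mulr1 //.
by exists (fun y => ((y.1, y.2.1), y.2.2)); [case=> -[] | case=> ? []].
Qed.

Lemma bij_splitLast l : bijective (@splitLast s l).
Proof. by exists (@joinLast s l); [exact: splitLastK | exact: joinLastK]. Qed.

Lemma bij_joinLast l : bijective (@joinLast s l).
Proof. by exists (@splitLast s l); [exact: joinLastK | exact: splitLastK]. Qed.

Lemma cptp_newEnc : cptp Enct -> cptp (newEnc Enct).
Proof.
move=> /cptpP [cE tE]; apply/cptpP; split.
  apply: (@eq_cp _ _ _ (pullback (@splitLast s lam) \o (@tensid _ _ _ Enct E \o addEpr))) => //.
  by do 2?apply: cp_comp; [apply: cp_addEpr | apply: cp_tensid | apply: cp_pullback].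
move=> S; rewrite -[newEnc Enct S]/(pullback (@splitLast s lam) (tensid Enct (addEpr S))).
by rewrite (sqtr_pullback_bij _ (bij_splitLast lam)) (sqtr_tensid _ cE.1 tE) tp_addEpr.
Qed.

Lemma newDecE Y : newDec Dect Y = meas (tensid Dect (pullback (@joinLast s lam) Y)).
Proof. by []. Qed.

Lemma cptp_newDec : cptp Dect -> cptp (newDec Dect).
Proof.
move=> /cptpP [cD tD]; apply/cptpP; split.
  apply: (@eq_cp _ _ _ (@meas R M lam \o (@tensid _ _ _ Dect E \o pullback (@joinLast s lam)))) => //.
  by do 2?apply: cp_comp; [apply: cp_pullback | apply: cp_tensid | apply: cp_meas].
move=> Y; rewrite newDecE tp_meas (sqtr_tensid _ cD.1 tD).
by rewrite (sqtr_pullback_bij _ (bij_joinLast lam)).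
Qed.

(** Tampering with the last share commutes with all that is done to the others, so it can be
    postponed until just before the measurement. *)
Lemma newDec_loApply (L : loT R (rcons s lam)) S : linmap Enct -> linmap Dect ->
  newDec Dect (loApply L (newEnc Enct S)) =
  meas (tensmap id (loLast L)
    (tensid (Dect \o loApply (loInit L) \o Enct) (addEpr S))).
Proof.
move=> lE lD; have lA := linmap_loApply (loInit L).
rewrite newDecE -[newEnc Enct S]/(pullback (@splitLast s lam) (tensid Enct (addEpr S))).
rewrite loApply_rcons (tensid_tensmap _ _ lA lD) (tensmap_tensid _ _ lE (linmap_comp lA lD)).
rewrite tensmap_tensid //; exact: linmap_comp lE (linmap_comp lA lD).
Qed.

Lemma newDec_newEnc S : is_code Enct Dect -> newDec Dect (newEnc Enct S) = emb S.
Proof.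
move=> code; have [[lE _ _] [lD _ _] _] := code; have lDE := linmap_comp lE lD.
rewrite newDecE -[newEnc Enct S]/(pullback (@splitLast s lam) (tensid Enct (addEpr S))).
have -> : pullback (@joinLast s lam) (pullback (@splitLast s lam) (tensid Enct (addEpr S)))
    = tensid Enct (addEpr S).
  by apply: sqP => x y; rewrite !pullbackE !joinLastK.
(* By inner correctness the measured operator is [S (x) Phi], which passes the test with fidelity
   and trace both one. *)
rewrite -tensid_comp // (@meas_prod _ _ _ _ S Phi).
- by rewrite fid_epr sqtr_epr subrr mulr0 scale0r addr0 scale1r.
- move=> m e f m' e' f'; rewrite (tensidE lDE) /= dec_enc_emb // ffunE /= blkE.
  exact: addEprE.
- by move=> f [o f']; rewrite (tensidE lDE) /= dec_enc_emb // ffunE.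
Qed.

Lemma is_code_new : is_code Enct Dect -> is_code (newEnc Enct) (newDec Dect).
Proof.
move=> code; have [cE cD _] := code.
split; [exact: cptp_newEnc | exact: cptp_newDec | move=> K rho _].
have l : linmap (newDec Dect \o newEnc Enct).
  by apply: linmap_comp; [case: (cptp_newEnc cE) | case: (cptp_newDec cD)].
apply: sqP => -[o k] [o' k']; rewrite (tensidE l) /= newDec_newEnc // !ffunE /=.
by case: o o' => [m|] [m'|] //; rewrite blkE.
Qed.
End Construction.

(** * Security *)

Section Reduction.
Variables (R : realType) (M : finType) (lam : nat).
Local Notation C := (R[i]).
Local Notation E := 'I_(2 ^ lam).
Local Notation OM := (option (M * E)).
Local Notation dim := ((2 ^ lam)%:R : C).
Local Notation Phi := (epr R (2 ^ lam)).

Definition mixedE : sq R E := dim^-1 *: sqid R E.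

Lemma psd_mixedE : psd mixedE.
Proof. by apply: psdZ; [rewrite invr_ge0 ler0n | exact: psd_sqid]. Qed.

Lemma sqtr_mixedE : sqtr mixedE = 1.
Proof. by rewrite sqtrZ sqtr_sqid card_ord mulVf // dim_neq0. Qed.

Lemma tensmap_idE (I J : finType) (L : sq R J -> sq R J) (W : sq R (I * J)%type) i j i' j' :
  tensmap id L W ((i, j), (i', j')) =
  \sum_a \sum_b W ((i, a), (i', b)) * L (mxu R a b) (j, j').
Proof. by rewrite tensmapE //; do 2![apply: eq_bigr => ? _]; rewrite blkE. Qed.

(* The canonical square root of [sigma (x) I/2^lam]; its purification is
   [pur S (x) Phi] up to the order of the registers. *)
Definition extS (S : sq R M) : sq R (M * E)%type := sqrtC (dim^-1) *: tens S (sqid R E).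

Section Message.
Variable S : sq R M.
Hypothesis psdS : psd S.
Let rho := pur S.
Let rho' := pur (extS S).

Lemma psd_extS : psd (extS S).
Proof.
apply: psdZ; first by rewrite sqrtC_ge0 invr_ge0 ler0n.
by rewrite sqid_gram; apply: psd_tens_gram.
Qed.

Lemma is_state_extS : is_state (sqmul S S) -> is_state (sqmul (extS S) (extS S)).
Proof.
move=> [_ tr1]; split.
  by move=> v; apply/qf_sqmul_ge0/psd_herm/psd_extS.
have -> : sqmul (extS S) (extS S) = dim^-1 *: tens (sqmul S S) (sqid R E).
  have : sqrtC (dim^-1) * sqrtC (dim^-1) = dim^-1 by rewrite -expr2 sqrtCK.
  (* Writing [dim^-1] as [r * r] makes the identity polynomial. *)
  rewrite /extS; move: (sqrtC _) => r <-.
  apply: sqP => -[m e] [m' e']; rewrite sqscaleE tensE !sqmulE.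
  rewrite sqidE -[in RHS](sum_delta e (fun f => (f == e')%:R)) sum_pair.
  rewrite big_distrl big_distrr; apply: eq_bigr => m'' _ /=.
  rewrite !big_distrr; apply: eq_bigr => f _ /=.
  rewrite !sqscaleE !tensE !sqidE (eq_sym e).
  by ring.
by rewrite sqtrZ sqtr_tens tr1 mul1r sqtr_sqid card_ord mulVf // dim_neq0.
Qed.

Lemma pur_extS m e mh eh m' e' mh' eh' :
  rho' (((m, e), (mh, eh)), ((m', e'), (mh', eh'))) =
  rho ((m, mh), (m', mh')) * Phi ((e, eh), (e', eh')).
Proof.
rewrite !purE !sqscaleE !tensE !sqidE !rmorphM /= conjc_nat eprE.
rewrite [conjc (sqrtC _)]conjc_ge0_id ?sqrtC_ge0 ?invr_ge0 ?ler0n //.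
have : sqrtC (dim^-1) * sqrtC (dim^-1) = dim^-1 by rewrite -expr2 sqrtCK.
by move: (sqrtC _) => r <-; rewrite -mulnb natrM; ring.
Qed.

Lemma ptr1_extS mh f mh' f' :
  ptr1 rho' ((mh, f), (mh', f')) = ptr1 rho (mh, mh') * mixedE (f, f').
Proof.
rewrite !ptr1E sum_pair big_distrl; apply: eq_bigr => m _ /=.
rewrite sqscaleE sqidE -(sum_delta f (fun e => (e == f')%:R)) !big_distrr.
by apply: eq_bigr => e _; rewrite pur_extS eprE -mulnb natrM.
Qed.

Lemma embLE (I K : finType) (X : sq R (I * K)%type) o k o' k' :
  embL X ((o, k), (o', k')) = emb (blk X k k') (o, o').
Proof. by rewrite !ffunE /=; case: o o' => [a|] [b|] //; rewrite blkE. Qed.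

Variable L : sq R E -> sq R E.
Hypothesis cptpL : cptp L.

(* What happens to [M' E' Ehat] after the first [t] shares have been decoded:
   the last share is tampered with, then the projective measurement is applied. *)
Definition finish : sq R (OM * E)%type -> sq R (option M) := @meas R M lam \o tensmap id L.

Lemma cp_finish : cp finish.
Proof. by have [cL _] := (cptpP L).1 cptpL; apply: cp_comp; [apply: cp_idtens | apply: cp_meas]. Qed.

Lemma tp_finish : tp finish.
Proof. by move=> W; have [l t _] := cptpL; rewrite /finish /= tp_meas tp_idtens. Qed.

(** The purified inner message has reference [Mhat Ehat]; the pullback moves [Ehat] to the system
    side, where [finish] acts, and keeps [Mhat] as reference. *)
Definition finishR (Z : sq R (OM * (M * E))%type) : sq R (option M * M)%type :=
  tensid finish (pullback (fun x => (x.1.1, (x.2, x.1.2))) Z).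

Lemma psd_finishR Z : psd Z -> psd (finishR Z).
Proof. by move=> pZ; apply: cp_finish.2; apply: psd_pullback. Qed.

Lemma sqtr_finishR Z : sqtr (finishR Z) = sqtr Z.
Proof.
rewrite /finishR (sqtr_tensid _ cp_finish.1 tp_finish) sqtr_pullback_bij //.
by exists (fun y => ((y.1, y.2.2), y.2.1)); [case=> -[] | case=> ? []].
Qed.

Lemma linmap_finishR : linmap finishR.
Proof.
move=> a X Y; rewrite /finishR.
rewrite (cp_pullback R (fun x : (OM * E) * M => (x.1.1, (x.2, x.1.2)))).1.
exact: linmap_tensid.
Qed.

Lemma finishRE Z o mh o' mh' :
  finishR Z ((o, mh), (o', mh')) =
  finish (blk (pullback (fun x => (x.1.1, (x.2, x.1.2))) Z) mh mh') (o, o').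
Proof. by rewrite /finishR (tensidE cp_finish.1). Qed.

(** The entanglement fidelity of [L]. *)
Definition fidL : C := fid (tensmap id L Phi).

Lemma fidL_itv : (0 < #|M|)%N -> 0 <= fidL <= 1.
Proof.
move=> M0; have [cL tL] := (cptpP L).1 cptpL.
have pw : psd (tensmap id L Phi) by apply: (cp_psd (cp_idtens _ cL)); apply: psd_epr.
rewrite fid_ge0 //=; apply: le_trans (fid_le_sqtr M0 pw) _.
by rewrite (tp_idtens cL.1 tL) sqtr_epr.
Qed.

Lemma finishR_emb :
  finishR (embL rho') = fidL *: embL rho + (1 - fidL) *: tens (botst R M) (ptr1 rho).
Proof.
have [lL tL _] := cptpL.
apply: sqP => -[o mh] [o' mh']; rewrite finishRE [RHS]sqaddE.
rewrite [X in _ = X + _]sqscaleE [X in _ = _ + X]sqscaleE embLE tensE.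
set W0 := blk (pullback _ _) _ _.
have W0E m e f m' e' f' : W0 ((Some (m, e), f), (Some (m', e'), f')) =
    blk rho mh mh' (m, m') * Phi ((e, f), (e', f')).
  by rewrite [LHS]blkE pullbackE embLE ffunE /= !blkE pur_extS.
have W0N f k : W0 ((None, f), k) = 0.
  by case: k => o'' f'; rewrite [LHS]blkE pullbackE embLE ffunE.
rewrite /finish /= (@meas_prod _ _ _ _ (blk rho mh mh') (tensmap id L Phi)).
- rewrite sqaddE !sqscaleE tp_idtens // sqtr_epr -/fidL; congr (_ + _).
  (* The trace of the block at [mh, mh'] is the matching entry of the reference marginal, so
     rejection leaves [bot] decoupled from [Mhat]. *)
  rewrite mulrC [_ * (1 - _)]mulrC mulrCA; congr (_ * (_ * _)).
  by rewrite /sqtr ptr1E; apply: eq_bigr => m _; rewrite blkE.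
- move=> m e f m' e' f'; rewrite !tensmap_idE big_distrr; apply: eq_bigr => a _ /=.
  by rewrite big_distrr; apply: eq_bigr => b _ /=; rewrite W0E mulrA.
- move=> f [o'' f']; rewrite tensmap_idE big1 // => a _; rewrite big1 // => b _.
  by rewrite W0N mul0r.
Qed.

Variable gam : sq R OM.
Hypothesis stgam : is_state gam.

(* Unnormalised output of an accepting measurement on [gam (x) L(I/2^lam)]. *)
Definition leak : sq R (option M) := acc (tens gam (L mixedE)).

Lemma tensmap_id_tens : tensmap id L (tens gam mixedE) = tens gam (L mixedE).
Proof.
have [lL _ _] := cptpL.
apply: sqP => -[o f] [o' f']; rewrite tensmap_idE tensE (linmapE lL) big_distrr.
apply: eq_bigr => a _; rewrite big_distrr; apply: eq_bigr => b _ /=.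
by rewrite tensE mulrA.
Qed.

Lemma psd_tens_gamL : psd (tens gam (L mixedE)).
Proof.
have [cL _] := (cptpP L).1 cptpL.
rewrite -tensmap_id_tens; apply: (cp_psd (cp_idtens _ cL)); rewrite /mixedE sqid_gram.
have -> : tens gam (dim^-1 *: gram (fun a i : E => (i == a)%:R)) =
    dim^-1 *: tens gam (gram (fun a i : E => (i == a)%:R)).
  by apply: sqP => -[? ?] [? ?]; rewrite sqscaleE !tensE sqscaleE; ring.
by apply: psdZ; [rewrite invr_ge0 ler0n | apply: psd_tens_gram; case: stgam].
Qed.

Lemma psd_leak : psd leak.
Proof. exact/psd_acc/psd_tens_gamL. Qed.

Lemma sqtr_leak : sqtr leak <= dim^-1.
Proof.
have [pg tg] := stgam; have [cL tL] := (cptpP L).1 cptpL.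
(* The marginal of [gam] on [E'], restricted to the non-[bot] part; its trace falls short of one by
   the weight of [gam] on [bot]. *)
pose gamE : sq R E := \sum_m pullback (fun g => Some (m, g)) gam.
have pgE : psd gamE.
  by rewrite /gamE; apply: big_ind => [||m _]; [exact: psd0 | exact: psdD | exact: psd_pullback].
have -> : sqtr leak = dim^-1 * \sum_g \sum_h gamE (g, h) * L mixedE (g, h).
  rewrite /sqtr sum_option ffunE add0r; under eq_bigr do rewrite ffunE /=.
  rewrite -mulr_sumr exchange_big; congr (_ * _); apply: eq_bigr => g _ /=.
  rewrite exchange_big; apply: eq_bigr => h _ /=; rewrite sum_ffunE big_distrl.
  by apply: eq_bigr => m _ /=; rewrite tensE pullbackE.
rewrite -[leRHS]mulr1; apply: ler_wpM2l; first by rewrite invr_ge0 ler0n.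
apply: le_trans (sum_mul_psd_le pgE (cp_psd cL psd_mixedE)) _.
rewrite tL sqtr_mixedE mulr1 -tg [leRHS]sum_option sum_pair.
rewrite /sqtr; under eq_bigr do rewrite sum_ffunE.
rewrite exchange_big /=; under eq_bigr => m _ do under eq_bigr do rewrite pullbackE.
by rewrite lerDr; apply: psd_diag_ge0.
Qed.

(** The marginal of [rho'] is [ptr1 rho (x) I/2^lam], so the message reference stays a tensor factor
    and the measurement sees only [gam (x) L(I/2^lam)]. *)
Lemma finishR_tens :
  finishR (tens gam (ptr1 rho')) =
  tens leak (ptr1 rho) + (1 - sqtr leak) *: tens (botst R M) (ptr1 rho).
Proof.
have [lL tL _] := cptpL; have [_ tg] := stgam.
apply: sqP => -[o mh] [o' mh']; rewrite finishRE [RHS]sqaddE.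
rewrite [X in _ = _ + X]sqscaleE !tensE.
have -> : blk (pullback (fun x => (x.1.1, (x.2, x.1.2))) (tens gam (ptr1 rho'))) mh mh' =
    ptr1 rho (mh, mh') *: tens gam mixedE.
  apply: sqP => -[a f] [a' f']; rewrite blkE pullbackE /= [RHS]sqscaleE !tensE ptr1_extS.
  by ring.
rewrite (linmapZ cp_finish.1) sqscaleE /finish /=.
rewrite tensmap_id_tens measE sqaddE sqscaleE sqtr_tens tg tL sqtr_mixedE mulr1 -/leak.
by ring.
Qed.

End Message.
End Reduction.

Section Security.
Variables (R : realType) (M : finType) (s : seq nat) (lam : nat).
Local Notation C := (R[i]).
Local Notation E := 'I_(2 ^ lam).
Local Notation dim := ((2 ^ lam)%:R : C).
Variables (Enct : sq R (M * E)%type -> sq R (sharesT s))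
          (Dect : sq R (sharesT s) -> sq R (option (M * E))).

Lemma herm_embL (I K : finType) (X : sq R (I * K)%type) : herm X -> herm (embL X).
Proof.
move=> hX -[o k] [o' k']; rewrite !embLE !ffunE /=.
by case: o o' => [a|] [b|]; rewrite ?blkE ?(hX (a, k)) //= oppr0.
Qed.

(** Adjoining EPR pairs to a block of [pur S] gives, by [pur_extS], the corresponding blocks of
    [pur (extS lam S)]. So an attack on the extended code is an attack on the inner code with [Ehat]
    held in the reference, followed by [finishR]. *)
Lemma tamper_extS (L : loT R (rcons s lam)) (S : sq R M) :
  linmap Enct -> linmap Dect -> cptp (loLast L) ->
  tensid (newDec Dect \o loApply L \o newEnc Enct) (pur S) =
  finishR (loLast L) (tensid (Dect \o loApply (loInit L) \o Enct) (pur (extS lam S))).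
Proof.
move=> lE lD cL; have lA := linmap_loApply (loInit L).
have lG := linmap_comp lE (linmap_comp lA lD).
have eN X : (newDec Dect \o loApply L \o newEnc Enct) X =
    finish (loLast L) (tensid (Dect \o loApply (loInit L) \o Enct) (addEpr lam X)).
  exact: newDec_loApply.
have lN : linmap (newDec Dect \o loApply L \o newEnc Enct).
  move=> a X Y; rewrite !eN (cp_addEpr R M lam).1 (linmap_tensid _ _).
  by rewrite (cp_finish M cL).1.
move: (newDec Dect \o loApply L \o newEnc Enct) eN lN => N eN lN.
apply: sqP => -[o mh] [o' mh'].
transitivity (N (blk (pur S) mh mh') (o, o')); first exact: tensidE.
rewrite eN; apply: etrans (esym (finishRE cL _ _ _ _ _)).
apply: (congr1 (fun W => finish (loLast L) W (o, o'))).
apply: sqP => -[a f] [a' f']; rewrite (tensidE lG) [RHS]blkE [RHS]pullbackE (tensidE lG).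
congr ((Dect \o loApply (loInit L) \o Enct) _ _).
apply: sqP => -[m e] [m' e']; rewrite [LHS]blkE [RHS]blkE addEprE pur_extS.
by rewrite blkE.
Qed.

(** The coefficients of [B] add up to [p (1 - q) + (1 - p) (1 - r) - (1 - p q) = - (1 - p) r], so
    the total error becomes a difference of two positive operators. *)
Lemma mixture_rearrange (I : finType) (Zp Zm W D B : sq R I) (p q r : C) :
  Zp - Zm + p *: (q *: W + (1 - q) *: B) + (1 - p) *: (D + (1 - r) *: B)
    - (p * q *: W + (1 - p * q) *: B) =
  (Zp + (1 - p) *: D) - (Zm + ((1 - p) * r) *: B).
Proof.
apply: sqP => i j; rewrite [LHS]sqsubE [RHS]sqsubE.
rewrite [X in X - _ = _]sqaddE [X in X + _ - _ = _]sqaddE [X in X + _ + _ - _ = _]sqsubE.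
rewrite [X in _ + X + _ - _ = _]sqscaleE [X in _ + X - _ = _]sqscaleE.
rewrite [X in _ + _ * X + _ - _ = _]sqaddE [X in _ + _ * X - _ = _]sqaddE.
rewrite [X in _ - X = _]sqaddE [X in _ = _ - X]sqaddE [X in _ = X - _]sqaddE !sqscaleE.
by ring.
Qed.

Lemma td_secure_new (eps : R) : (0 < #|M|)%N -> is_code Enct Dect ->
  nm_secure (@LO R s) eps Enct Dect ->
  td_secure (@LO R (rcons s lam)) (eps + 2 / 2 ^+ lam) (newEnc Enct) (newDec Dect).
Proof.
move=> M0 code nm _ [L [vL ->]]; have [cE cD _] := code.
have [lE _ pE] := cE; have [lD _ _] := cD.
have [vI cL] := loValid_rcons vL.
have [p [p01 [gam [stg sec]]]] := nm (loApply (loInit L)) (ex_intro _ (loInit L) (conj vI erefl)).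
have lA := linmap_loApply (loInit L); have hA := kherm_loApply vI.
set q := fidL (loLast L).
have q01 : 0 <= q <= 1 by apply: (fidL_itv cL M0).
have qR : q = ((complex.Re q)%:C)%C.
  by case/andP: q01 => /Im_ge0; case: (q) => x y /= ->.
have rq01 : 0 <= complex.Re q <= 1 by move: q01; rewrite {1 2}qR !lecR.
(* The message survives if the inner ideal channel keeps it (weight [p]) and the EPR test passes
   (weight [q]); [q] is a real number living in [R[i]]. *)
exists (p * complex.Re q); split.
  by case/andP: p01 => ? ?; case/andP: rq01 => ? ?; rewrite mulr_ge0 //= mulr_ile1.
move=> sigma S st pS eS rho.
have st' : is_state (sqmul S S) by rewrite eS.
have := sec _ _ (is_state_extS lam pS st') (psd_extS pS) erefl.
rewrite /=; set rho' := pur (extS lam S); set X := _ - _ => trX.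
have [pgam _] := stg.
have hX : herm X.
  apply: hermB.
    rewrite (tensid_comp _ lE (linmap_comp lA lD)) (tensid_comp _ lA lD).
    apply: (herm_tensid lD (cptp_kherm cD)); apply: (herm_tensid lA hA).
    exact/psd_herm/pE/psd_pur.
  apply: hermD; apply: hermZ; first by apply/herm_embL/psd_herm/psd_pur.
  by rewrite /rho' ptr1_pur_gram; apply/psd_herm/psd_tens_gram.
have [Xp [Xm [pXp pXm eX trle]]] := trnorm_split hX trX.
have lF : linmap (@finishR R M lam (loLast L)) by apply: linmap_finishR.
have eta : tensid (newDec Dect \o loApply L \o newEnc Enct) rho =
   finishR (loLast L) Xp - finishR (loLast L) Xm
   + (p%:C)%C *: finishR (loLast L) (embL rho')
   + ((1 - p)%:C)%C *: finishR (loLast L) (tens gam (ptr1 rho')).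
  rewrite tamper_extS // -(linmapB lF) -eX -!(linmapZ lF).
  by rewrite -!(linmapD lF) -addrA subrK.
have [_ tr1] := st'.
have psdt (D : sq R (option M)) : psd D -> psd (tens D (ptr1 rho)).
  by move=> pD; rewrite /rho ptr1_pur_gram; apply: psd_tens_gram.
have sqtrt (D : sq R (option M)) : sqtr (tens D (ptr1 rho)) = sqtr D.
  by rewrite sqtr_tens sqtr_ptr1_pur // tr1 mulr1.
set D := leak (loLast L) gam; set r := sqtr D.
have r0 : 0 <= r by apply/psd_sqtr_ge0/psd_leak.
have rle : r <= dim^-1 by apply: sqtr_leak.
have cp0 : 0 <= ((1 - p)%:C)%C by rewrite lecR subr_ge0; case/andP: p01.
have cp1 : ((1 - p)%:C)%C <= 1 :> C by rewrite lecR lerBlDr lerDl; case/andP: p01.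
have pB : psd (botst R M).
  have -> : botst R M = gram (fun (_ : unit) o => (o == None)%:R).
    by apply: sqP => i j; rewrite gramE (big_pred1 tt) => [|[]//]; rewrite mxuE conjc_nat -natrM mulnb.
  exact: psd_gram.
have -> : tensid (newDec Dect \o loApply L \o newEnc Enct) rho -
    (((p * complex.Re q)%:C)%C *: embL rho +
     ((1 - p * complex.Re q)%:C)%C *: tens (botst R M) (ptr1 rho)) =
    (finishR (loLast L) Xp + ((1 - p)%:C)%C *: tens D (ptr1 rho)) -
    (finishR (loLast L) Xm + (((1 - p)%:C)%C * r) *: tens (botst R M) (ptr1 rho)).
  rewrite eta (finishR_emb S cL) (finishR_tens S cL stg) -/q -/D -/r -/rho.
  rewrite !rmorphB !rmorphM !rmorph1 /= -qR.
  exact: mixture_rearrange.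
apply: trnorm_bound.
- by apply: psdD; [exact: psd_finishR | apply: psdZ => //; apply/psdt/psd_leak].
- by apply: psdD; [exact: psd_finishR | apply: psdZ; [apply: mulr_ge0 | apply: psdt]].
move: (sqtr_finishR cL Xp) (sqtr_finishR cL Xm).
move: (finishR _ Xp) (finishR _ Xm) => Zp Zm trZp trZm.
rewrite [X in X + _]sqtrD [X in _ + X <= _]sqtrD [X in _ + X + _]sqtrZ [X in _ + (_ + X)]sqtrZ.
rewrite (sqtrt D) (sqtrt (botst R M)) sqtr_botst mulr1 -/r trZp trZm.
have -> : ((eps + 2 / 2 ^+ lam)%:C)%C = (eps%:C)%C + 2 * dim^-1 :> C.
  by rewrite rmorphD rmorphM fmorphV rmorphXn !rmorph_nat natrX.
(* [D] and [r bot] each contribute trace [(1 - p) r <= 2^-lam], one to each positive part. *)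
have -> : sqtr Xp + ((1 - p)%:C)%C * r + (sqtr Xm + ((1 - p)%:C)%C * r) =
  (sqtr Xp + sqtr Xm) + 2 * (((1 - p)%:C)%C * r) by ring.
apply: lerD trle _; apply: ler_wpM2l; first exact: ler0n.
by apply: le_trans rle; apply: ler_piMl.
Qed.
End Security.
Theorem theorem3p1 (R : realType) (s : seq nat) (k lam : nat) (eps : R)
    (Enct : sq R ('I_(2 ^ (k - lam)) * 'I_(2 ^ lam))%type -> sq R (sharesT s))
    (Dect : sq R (sharesT s) -> sq R (option ('I_(2 ^ (k - lam)) * 'I_(2 ^ lam))%type)) :
  (1 <= size s)%N -> (0 < lam < k)%N ->
  is_code Enct Dect ->
  nm_secure (@LO R s) eps Enct Dect ->
  [/\ is_code (newEnc Enct) (newDec Dect),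
      td_secure (@LO R (rcons s lam)) (eps + 2 / 2 ^+ lam) (newEnc Enct) (newDec Dect),
      #|'I_(2 ^ (k - lam))| = (2 ^ (k - lam))%N,
      #|{: 'I_(2 ^ (k - lam)) * 'I_(2 ^ lam)}| = (2 ^ k)%N &
      sumn (rcons s lam) = (sumn s + lam)%N].
Proof.
move=> _ /andP[_ lam_lt_k] code nm; split.
- exact: is_code_new.
- by apply: td_secure_new => //; rewrite card_ord expn_gt0.
- exact: card_ord.
(* [lam < k] makes the truncated subtraction exact. *)
- by rewrite card_prod !card_ord -expnD subnK // ltnW.
- exact: sumn_rcons.
Qed.
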